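(* Let $T>0$, $D=(-1,1)$, $0<\beta,\hat\beta<1$, $0<\alpha\le\gamma<2$ and $0<\hat\alpha\le\hat\gamma<2$. Let $f\in\dot H^{\alpha,\gamma}\cap\dot H^{\hat\alpha,\hat\gamma}\subset L^2(D)$ satisfy $$\text{either}\quad \langle f,\psi_n\rangle>0\ \text{ for all odd } n\ge1,\qquad\text{or}\quad \langle f,\psi_n\rangle<0\ \text{ for all odd } n\ge1.$$ Let $u$ be the weak solution of $$\begin{cases}\partial_t^\beta u(t,x)=-(-\Delta)^{\alpha/2}u(t,x)-(-\Delta)^{\gamma/2}u(t,x), & t>0,\ x\in D,\\ u(t,-1)=u(t,1)=0, & 0<t\le T,\\ u(0,x)=f(x), & x\in D,\end{cases}$$ and let $v$ be the weak solution of $$\begin{cases}\partial_t^{\hat\beta} v(t,x)=-(-\Delta)^{\hat\alpha/2}v(t,x)-(-\Delta)^{\hat\gamma/2}v(t,x), & t>0,\ x\in D,\\ v(t,-1)=v(t,1)=0, & 0<t\le T,\\ v(0,x)=f(x), & x\in D.\end{cases}$$ If $u(t,0)=v(t,0)$ for all $0<t\le T$, then $\beta=\hat\beta$, $\alpha=\hat\alpha$ and $\gamma=\hat\gamma$.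
   Context: Caputo derivative, for $0<\beta<1$: $\partial_t^\beta q(t)=\frac{1}{\Gamma(1-\beta)}\int_0^t \frac{\partial q(s)}{\partial s}\frac{ds}{(t-s)^\beta}$. Mittag-Leffler function: $E_\beta(z)=\sum_{k\ge0}\frac{z^k}{\Gamma(\beta k+1)}$. Dirichlet eigenpairs of $-\Delta$ on $D=(-1,1)$: $\bar\mu_n=(n\pi/2)^2$, $\psi_n(x)=\sin\big[\tfrac{n\pi}{2}(x+1)\big]$, $n\ge1$; $(\psi_n)$ is an orthonormal basis of $L^2(D)$, and $\langle\cdot,\cdot\rangle$ is the inner product of $L^2(D)$. Put $\mu_n=\bar\mu_n^{\alpha/2}+\bar\mu_n^{\gamma/2}$. The space $\dot H^{\alpha,\gamma}$ is $\{w\in L^2(D):\sum_{n\ge1}\mu_n^2\langle w,\psi_n\rangle^2<\infty\}$, with norm $\big(\sum_{n\ge1}\mu_n^2\langle w,\psi_n\rangle^2\big)^{1/2}$. The operator $\mathtt L_D^{\alpha,\gamma}:=-(-\Delta)^{\alpha/2}-(-\Delta)^{\gamma/2}$ is defined spectrally by $\mathtt L_D^{\alpha,\gamma}w=-\sum_{n\ge1}\mu_n\langle w,\psi_n\rangle\psi_n$. Weak solution (for parameters $\beta,\alpha,\gamma$): $u(t,\cdot)\in\dot H^{\alpha,\gamma}$ for each $t>0$; $u(t,\cdot)=0$ on $\partial D$ for $0<t\le T$; $\lim_{t\downarrow0}u(t,x)=f(x)$ a.e.; $\partial_t^\beta u(t,\cdot)=\mathtt L_D^{\alpha,\gamma}u(t,\cdot)$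 in $L^2(D)$. The unique weak solution is given by the expansion $u(t,x)=\sum_{n\ge1}E_\beta(-\mu_nt^\beta)\langle f,\psi_n\rangle\psi_n(x)$, and similarly $v(t,x)=\sum_{n\ge1}E_{\hat\beta}(-\lambda_nt^{\hat\beta})\langle f,\psi_n\rangle\psi_n(x)$ with $\lambda_n=\bar\mu_n^{\hat\alpha/2}+\bar\mu_n^{\hat\gamma/2}$. The quantities $u(t,0)$ and $v(t,0)$ denote the values of these series at $x=0$ (taken to be convergent there). *)

(* Defs.v *)
From HB Require Import structures.
From mathcomp Require Import all_boot all_order all_algebra.
From mathcomp Require Import all_classical all_reals all_analysis.

Set Implicit Arguments.
Unset Strict Implicit.
Unset Printing Implicit Defensive.

Import Order.TTheory GRing.Theory Num.Theory.
Import numFieldNormedType.Exports.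

Local Open Scope classical_set_scope.
Local Open Scope ring_scope.

Section special_functions.
Context {R : realType}.
Notation mu := (@lebesgue_measure R).

Definition Gamma (x : R) : R :=
  \int[mu]_(s in `]0, +oo[) (s `^ (x - 1) * expR (- s)).

Definition mittag_leffler (beta z : R) : R :=
  limn (series (fun k : nat => z ^+ k / Gamma (beta * k%:R + 1))).

(* A relation rather than a function: the derivative and the integral are total
   operations in the library, so their existence is made explicit. *)
Definition is_caputo (beta : R) (q : R -> R) (t l : R) : Prop :=
  [/\ forall s, 0 < s < t -> derivable q s 1,
      mu.-integrable `]0, t[ (fun s => (derive1 q s / (t - s) `^ beta)%:E) &
      l = (Gamma (1 - beta))^-1 *
          \int[mu]_(s in `]0, t[) (derive1 q s / (t - s) `^ beta)].

End special_functions.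

Section interval_domain.
Context {R : realType}.
Notation mu := (@lebesgue_measure R).

Definition D : set R := `]-1, 1[.

(* Elements of L^2(D) are represented by functions on the whole line whose
   values outside D are irrelevant, except that the boundary condition below
   reads the chosen representative at -1 and 1. *)
Definition L2D (w : R -> R) : Prop := (w \_ D) \in Lfun mu 2%:E.

Definition inner (f g : R -> R) : R := \int[mu]_(x in D) (f x * g x).

Definition L2D_cvg (F : nat -> R -> R) (g : R -> R) : Prop :=
  (fun N : nat => ('N[mu]_(2%:E)[EFin \o ((fun x => F N x - g x)%R \_ D)])%E)
    @ \oo --> 0%E.

(* Eigenpairs are meant for indices n >= 1. *)
Definition mubar (n : nat) : R := (n%:R * pi / 2) ^+ 2.

Definition psi (n : nat) (x : R) : R := sin (n%:R * pi / 2 * (x + 1)).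

Definition eigval (alpha gamma : R) (n : nat) : R :=
  mubar n `^ (alpha / 2) + mubar n `^ (gamma / 2).

Definition Hdot (alpha gamma : R) (w : R -> R) : Prop :=
  L2D w /\
  cvgn (fun N : nat =>
    \sum_(1 <= n < N) eigval alpha gamma n ^+ 2 * inner w (psi n) ^+ 2).

(* [is_LD alpha gamma w g]: the series defining the operator applied to w
   converges in L^2(D), with sum g (determined up to a.e. equality on D). *)
Definition is_LD (alpha gamma : R) (w g : R -> R) : Prop :=
  L2D g /\
  L2D_cvg (fun N x =>
    - \sum_(1 <= n < N) eigval alpha gamma n * inner w (psi n) * psi n x) g.

(* [u t x] is a representative of u(t, x).  The Caputo derivative is taken in t
   for fixed x, and the equation in L^2(D) is equality a.e. on D. *)
Definition weak_solution (T beta alpha gamma : R) (f : R -> R)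
    (u : R -> R -> R) : Prop :=
  [/\ forall t, 0 < t -> Hdot alpha gamma (u t),
      forall t, 0 < t <= T -> u t (-1) = 0 /\ u t 1 = 0,
      {ae mu, forall x, D x -> u t x @[t --> 0^'+] --> f x} &
      forall t, 0 < t -> exists2 g, is_LD alpha gamma (u t) g &
        {ae mu, forall x, D x -> is_caputo beta (u ^~ x) t (g x)}].

Definition expansion (beta alpha gamma : R) (f : R -> R) (t x : R) (N : nat)
    : R :=
  \sum_(1 <= n < N)
    mittag_leffler beta (- eigval alpha gamma n * t `^ beta) *
    inner f (psi n) * psi n x.

End interval_domain.

(* Main.v *)
Require Import Defs.
From HB Require Import structures.
From mathcomp Require Import all_boot all_order all_algebra.
From mathcomp Require Import all_classical all_reals all_analysis.
From mathcomp Require Import measurable_realfun ring lra.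

Set Implicit Arguments.
Unset Strict Implicit.
Unset Printing Implicit Defensive.

Import Order.TTheory GRing.Theory Num.Theory.
Import numFieldNormedType.Exports.

Local Open Scope classical_set_scope.
Local Open Scope ring_scope.

(** At the midpoint the even eigenfunctions vanish and the odd ones take the
    values 1 and -1, so no weight [c_j = <f, psi_(2j+1)> psi_(2j+1)(0)] vanishes.
    Writing [m_j] for the eigenvalue of index [2j+1], the hypothesis says that
    two series [sum_j c_j E_beta(- m_j t^beta)], one for each triple of
    parameters, agree for [0 < t <= T].  They then agree for all [t > 0] by
    analyticity, and their expansions at infinity must coincide.  The term of
    order [t^(- beta k)] carries the coefficient [1 / Gamma(1 - beta k)] times
    the moment [sum_j c_j m_j^(-k)]; the exponents that occur reveal [beta], the
    moments of large order reveal the [m_j] one after the other, and the growth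
    of [m_j] reveals first [gamma] and then [alpha].

    Analyticity has to be uniform in the mode.  In the variable [y = ln t] every
    mode is a translate of one function, so it is enough to bound the iterates
    of the Euler operator, [|(x d/dx)^i E_(beta,b)(-x)| <= C i! r^i] for all
    [x > 0] (lemma [ML_theta_bound]).  For [b >= 1] this comes from a discrete
    model: [E_(beta,b)(-x)] is the limit of the suitably normalized coefficient
    of [z^n] in [(1 - z)^(beta - b) / ((1 - z)^beta + x n^(-beta))].  That
    coefficient obeys a recursion with nonnegative weights, hence a maximum
    principle ([ML_theta_bound_ge1]); the passage to the limit is Gauss's
    formula for the Gamma function ([nbin_powR_cvg]).  Smaller values of [b],
    which govern the remainders of the expansion at infinity ([ML_expansion]),
    are reached through the relation between [b] and [b - 1] given by the
    Euler operator ([ML_theta_pred]).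

    When [gamma] is small the series need not converge absolutely, and it is
    given to converge only for [t <= T].  A finite combination of translates in
    [y], chosen to annihilate the first terms of both expansions at infinity
    ([killing_poly]), restores absolute convergence and alters no later term
    beyond a factor that is nonzero for large [k].

    The coefficient [1 / Gamma(1 - beta k)] vanishes when [beta k] is an
    integer, so some exponents are invisible.  The remaining ones still
    determine [beta] ([progression_step_eq]), and they include moments of
    arbitrarily large order, which suffices to recover the [m_j]
    ([moments_inj]), the smallest node dominating the moments of large order. *)

(** * The Gamma function on [1, +oo[ *)

Section gamma.
Context {R : realType}.
Notation mu := (@lebesgue_measure R).
Notation halfline := (`]0, +oo[%classic : set R).

Let mhalf : measurable (halfline : set (measurableTypeR R)).
Proof. exact: measurable_itv. Qed.

Lemma powR_le_expRhalf (p : R) : 0 <= p ->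
  exists2 d : R, 0 <= d & forall s, 0 <= s -> s `^ p <= d * expR (s / 2).
Proof.
move=> p0; have [n pn] : exists n, p <= n.+1%:R.
  exists (Num.truncn p); exact/ltW/truncnS_gt.
exists (1 + 2 ^+ n.+1 * n.+1`!%:R); first by rewrite addr_ge0// mulr_ge0.
move=> s s0.
have s20 : 0 <= s / 2 by rewrite divr_ge0.
have e1 : 1 <= expR (s / 2) by rewrite -[leLHS]expR0 ler_expR.
have [s1|s1] := leP s 1.
  have h : s `^ p <= 1.
    have [->|sn0] := eqVneq s 0.
      by rewrite /powR eqxx lern1 leq_b1.
    rewrite -(powRr0 s); apply: ger_powR => //.
    by rewrite lt0r sn0 s0.
  apply: (le_trans h); rewrite mulrDl mul1r; apply: (le_trans e1).
  by rewrite lerDl !mulr_ge0.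
have h : s `^ p <= s ^+ n.+1.
  by rewrite -powR_mulrn//; apply: ler_powR => //; exact: ltW.
apply: (le_trans h); rewrite mulrDl mul1r.
have := @expR_ge1Dxn R (s / 2) n s20.
rewrite expr_div_n => h2.
have f0 : (0 : R) < n.+1`!%:R by rewrite ltr0n fact_gt0.
have t0 : (0 : R) < 2 ^+ n.+1 by rewrite exprn_gt0.
have -> : s ^+ n.+1 = 2 ^+ n.+1 * n.+1`!%:R * (s ^+ n.+1 / 2 ^+ n.+1 / n.+1`!%:R).
  by field; rewrite !gt_eqF.
apply: ler_wpDl; first exact: ltW (expR_gt0 _).
apply: ler_wpM2l; first by rewrite mulr_ge0// ltW.
by apply: ltW; apply: lt_le_trans h2; rewrite ltrDr.
Qed.

Lemma gamma_kernel_le (p : R) : 0 <= p -> exists2 d : R, 0 <= d &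
  forall s, 0 <= s -> s `^ p * expR (- s) <= d * expR (- (s / 2)).
Proof.
move=> /powR_le_expRhalf[d d0 hd]; exists d => // s s0.
have -> : expR (- (s / 2)) = expR (s / 2) * expR (- s).
  by rewrite -expRD; congr expR; field.
by rewrite mulrA ler_wpM2r ?expR_ge0// hd.
Qed.

Lemma continuous_expRhalf : continuous (fun s : R => expR (- (s / 2))).
Proof.
move=> x; apply: continuous_comp; last exact: continuous_expR.
by apply: continuousN; apply: cvgMl.
Qed.

Lemma measurable_expRhalf (D : set R) :
  measurable_fun D (fun s : R => expR (- (s / 2))).
Proof.
apply: measurable_funTS.
exact: continuous_measurable_fun continuous_expRhalf.
Qed.

Lemma cvg_expRhalf_y : expR (- (s / 2)) @[s --> +oo] --> (0 : R).
Proof.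
have -> : (fun s : R => expR (- (s / 2))) = (fun z => expR (- z)) \o (fun z => z / 2) by [].
apply: (@cvg_comp _ _ _ _ _ _ (pinfty_nbhs R)); last exact: cvgr_expR.
exact: gt0_cvgMly.
Qed.

Lemma measurable_gamma_kernel (p : R) (D : set R) :
  measurable_fun D (fun s : R => s `^ p * expR (- s)).
Proof.
apply: measurable_funTS; apply: measurable_funM; first exact: measurable_powR.
by apply: measurableT_comp => //; exact: measurableT_comp.
Qed.

Lemma integral_expRhalf :
  (\int[mu]_(s in halfline) (expR (- (s / 2)))%:E = 2%:E)%E.
Proof.
rewrite integral_itv_obnd_cbnd; last first.
  by apply/measurable_EFinP; exact: measurable_expRhalf.
rewrite (@ge0_continuous_FTC2y _ _ (fun s => - 2 * expR (- (s / 2))) _ 0).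
- by rewrite mul0r oppr0 expR0 mulr1 EFinN oppeK add0e.
- by move=> x _; exact: expR_ge0.
- exact: (continuous_subspaceT continuous_expRhalf).
- by rewrite -[X in _ --> X](mulr0 (-2)); apply: cvgMr; exact: cvg_expRhalf_y.
- by move=> x _; apply: ex_derive.
- by apply/cvg_at_right_filter; apply: cvgMr; exact: continuous_expRhalf.
- move=> x _; rewrite derive1E; rewrite derive_val.
  by rewrite !scaler0 ?add0r ?addr0 /GRing.scale/=; field.
Qed.

Lemma integrable_expRhalf : mu.-integrable halfline (EFin \o (fun s : R => expR (- (s / 2)))).
Proof.
apply/integrableP; split.
  by apply/measurable_EFinP; exact: measurable_expRhalf.
under eq_integral do rewrite /= ger0_norm ?expR_ge0//.
by rewrite integral_expRhalf ltry.
Qed.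

Lemma integrable_gamma_kernel (p : R) : 0 <= p ->
  mu.-integrable halfline (EFin \o (fun s : R => s `^ p * expR (- s))).
Proof.
move=> p0; have [d d0 hd] := gamma_kernel_le p0.
apply: (le_integrable mhalf (g := EFin \o (fun s : R => d * expR (- (s / 2))))).
- by apply/measurable_EFinP; exact: measurable_gamma_kernel.
- move=> s; rewrite /= in_itv/= andbT => s0; rewrite lee_fin.
  by rewrite !ger0_norm ?mulr_ge0 ?powR_ge0 ?expR_ge0// hd// ltW.
- exact: (integrableZl mhalf d integrable_expRhalf).
Qed.

Lemma powR_cvg_right0 (p : R) : 0 <= p -> s `^ p @[s --> (0:R)^'+] --> (0:R) `^ p.
Proof.
rewrite le_eqVlt => /predU1P[<-|p0].
  under eq_fun do rewrite powRr0.
  by rewrite powRr0; exact: cvg_cst.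
by rewrite powR0 ?gt_eqF//; exact: powR_cvg0.
Qed.

Lemma continuous_powR (p x : R) : 0 < x -> {for x, continuous (fun s : R => s `^ p)}.
Proof.
move=> x0; apply: differentiable_continuous; apply/derivable1_diffP.
by apply: derivable_powR; rewrite in_itv/= x0.
Qed.

Lemma cvg_gamma_kernel_y (p : R) : 0 <= p ->
  s `^ p * expR (- s) @[s --> +oo] --> (0:R).
Proof.
move=> p0; have [d d0 hd] := gamma_kernel_le p0.
apply: (@squeeze_cvgr _ _ _ _ (cst 0) (fun s : R => d * expR (- (s / 2)))).
- by near=> s; rewrite mulr_ge0 ?powR_ge0 ?expR_ge0//= hd.
- exact: cvg_cst.
- by rewrite -[X in _ --> X](mulr0 d); apply: cvgMr; exact: cvg_expRhalf_y.
Unshelve. all: by end_near. Qed.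

Lemma cvg_gamma_kernel_0 (p : R) : 0 <= p ->
  s `^ p * expR (- s) @[s --> (0:R)^'+] --> (0:R) `^ p * expR (- 0).
Proof.
move=> p0; apply: cvgM; first exact: powR_cvg_right0.
apply/cvg_at_right_filter; apply: continuous_comp; last exact: continuous_expR.
exact: continuousN.
Qed.

Lemma continuous_gamma_kernel (p x : R) : 0 < x ->
  {for x, continuous (fun s : R => s `^ p * expR (- s))}.
Proof.
move=> x0; apply: continuousM; first exact: continuous_powR.
apply: continuous_comp; last exact: continuous_expR.
exact: continuousN.
Qed.

Lemma GammaE (x : R) :
  Gamma x = \int[mu]_(s in halfline) (s `^ (x - 1) * expR (- s)).
Proof. by []. Qed.

(** Integration by parts on the half-line.  The derivative of [- s^x e^(-s)] has
    no sign, so a multiple of [e^(-s/2)] that makes it nonnegative is added and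
    integrated separately. *)
Lemma GammaS (x : R) : 1 <= x -> Gamma (x + 1) = x * Gamma x.
Proof.
move=> x1; have x10 : 0 <= x - 1 by rewrite subr_ge0.
have x0 : 0 < x by lra.
have [d d0 hd] := gamma_kernel_le x10.
pose f (s : R) := s `^ x * expR (- s) - x * (s `^ (x - 1) * expR (- s)) +
   x * d * expR (- (s / 2)).
pose F (s : R) := - (s `^ x * expR (- s)) - 2 * (x * d) * expR (- (s / 2)).
have i1 := integrable_gamma_kernel (ltW x0).
have i2 := integrable_gamma_kernel x10.
have i3 := integrable_expRhalf.
have i2x := integrableZl mhalf x i2.
have i3x := integrableZl mhalf (x * d) i3.
have I1 : \int[mu]_(s in halfline) f s = x * d * 2.
  rewrite Rintegral_itv_obnd_cbnd; last first.
    exact: (integrableD mhalf (integrableB mhalf i1 i2x) i3x).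
  rewrite (@Rintegral_ge0_continuous_FTC2y _ _ F _ 0).
  - by rewrite /F powR0 ?gt_eqF// !mul0r oppr0 expR0; ring.
  - move=> s s0; rewrite /f -addrA addr_ge0 ?mulr_ge0 ?powR_ge0 ?expR_ge0//.
    by rewrite addrC subr_ge0 -mulrA ler_wpM2l ?hd// ltW.
  - apply/continuous_within_itvcyP; split.
      move=> s; rewrite in_itv/= andbT => s0.
      apply: cvgD; last by apply: cvgMr; exact: continuous_expRhalf.
      apply: cvgB; first exact: continuous_gamma_kernel.
      by apply: cvgMr; exact: continuous_gamma_kernel.
    apply: cvgD; last by apply: cvgMr; apply/cvg_at_right_filter; exact: continuous_expRhalf.
    apply: cvgB; first by apply: cvg_gamma_kernel_0; exact: ltW.
    by apply: cvgMr; exact: cvg_gamma_kernel_0.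
  - rewrite -[X in _ --> X](_ : - 0 - 2 * (x * d) * 0 = 0); last by ring.
    apply: cvgB; first by apply: cvgN; apply: cvg_gamma_kernel_y; exact: ltW.
    by apply: cvgMr; exact: cvg_expRhalf_y.
  - by move=> s s0; have ? := is_derive1_powR x s0; exact: ex_derive.
  - apply: cvgB; first by apply: cvgN; apply: cvg_gamma_kernel_0; exact: ltW.
    by apply: cvgMr; apply/cvg_at_right_filter; exact: continuous_expRhalf.
  - move=> s; rewrite in_itv/= andbT => s0; rewrite derive1E.
    have ? := is_derive1_powR x s0.
    rewrite /F derive_val /f !scaler0 ?add0r ?addr0 /GRing.scale/=.
    by field.
have I2 : \int[mu]_(s in halfline) expR (- (s / 2)) = 2.
  by rewrite /Rintegral integral_expRhalf.
move: I1; rewrite /f RintegralD//; last first.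
  exact: (integrableB mhalf i1 i2x).
rewrite RintegralB// !RintegralZl// I2 -GammaE.
rewrite [Gamma (x + 1)]GammaE addrK => h.
by lra.
Qed.

Lemma Gamma1 : Gamma 1 = 1 :> R.
Proof.
rewrite GammaE subrr Rintegral_itv_obnd_cbnd; last first.
  exact: integrable_gamma_kernel.
rewrite (@Rintegral_ge0_continuous_FTC2y _ _ (fun s => - expR (- s)) _ 0).
- by rewrite !oppr0 expR0; ring.
- by move=> s s0; rewrite powRr0 mul1r expR_ge0.
- apply/continuous_within_itvcyP; split.
    by move=> s; rewrite in_itv/= andbT => s0; exact: continuous_gamma_kernel.
  exact: cvg_gamma_kernel_0.
- by rewrite -oppr0; apply: cvgN; exact: cvgr_expR.
- by move=> s s0; exact: ex_derive.
- apply: cvgN; apply/cvg_at_right_filter; apply: continuous_comp; last exact: continuous_expR.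
  exact: continuousN.
- move=> s s0; rewrite derive1E derive_val powRr0 /GRing.scale/=; ring.
Qed.

Lemma Gamma_natS (n : nat) : Gamma n.+1%:R = n`!%:R :> R.
Proof.
elim: n => [|n IH]; first by rewrite Gamma1.
by rewrite -natr1 GammaS ?ler1n// IH factS natrM.
Qed.

End gamma.

(** * Gauss's limit formula *)

Section gamma_asymptotics.
Context {R : realType}.
Notation mu := (@lebesgue_measure R).
Notation halfline := (`]0, +oo[%classic : set R).

Let mhalf : measurable (halfline : set (measurableTypeR R)).
Proof. exact: measurable_itv. Qed.

Lemma powR_Bernoulli_le (s p : R) : 0 <= s -> 0 <= p <= 1 ->
  s `^ p <= 1 + p * (s - 1).
Proof.
move=> s0 /andP[]; rewrite le_eqVlt => /predU1P[<- _|p0].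
  by rewrite powRr0 mul0r addr0.
rewrite le_eqVlt => /predU1P[->|p1].
  by rewrite powRr1// mul1r; lra.
have q0 : 0 < 1 - p by rewrite subr_gt0.
have := @conjugate_powR R (s `^ p) 1 p^-1 (1 - p)^-1 (powR_ge0 _ _) ler01.
rewrite !invr_gt0 !invrK => /(_ p0 q0) h.
have {h} := h (subrKC _ _).
rewrite mulr1 powR1 -powRrM mulfV ?gt_eqF// powRr1// mul1r.
by lra.
Qed.

Lemma powR_Bernoulli_ge (s p : R) : 0 <= s -> 1 <= p ->
  1 + p * (s - 1) <= s `^ p.
Proof.
move=> s0 p1; have p0 : 0 < p by lra.
have := @powR_Bernoulli_le (s `^ p) p^-1 (powR_ge0 _ _).
rewrite invr_ge0 (ltW p0) invf_le1// p1 => /(_ isT).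
rewrite -powRrM mulfV ?gt_eqF// powRr1// => h.
rewrite -subr_ge0.
have -> : s `^ p - (1 + p * (s - 1)) = p * (1 + p^-1 * (s `^ p - 1) - s).
  by field; rewrite gt_eqF.
by apply: mulr_ge0; [exact: ltW|rewrite subr_ge0].
Qed.

Lemma Gamma_linear (n : nat) (a b : R) :
  \int[mu]_(s in halfline)
    (a * (s `^ n%:R * expR (- s)) + b * (s `^ n.+1%:R * expR (- s))) =
  n`!%:R * (a + b * n.+1%:R).
Proof.
have i1 : mu.-integrable halfline (EFin \o (fun s : R => s `^ n%:R * expR (- s))).
  exact: integrable_gamma_kernel.
have i2 : mu.-integrable halfline (EFin \o (fun s : R => s `^ n.+1%:R * expR (- s))).
  exact: integrable_gamma_kernel.
have i1x := integrableZl mhalf a i1.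
have i2x := integrableZl mhalf b i2.
rewrite RintegralD// !RintegralZl//.
have G1 := @Gamma_natS R n; have G2 := @Gamma_natS R n.+1.
move: G1 G2; rewrite !GammaE -[n.+2%:R]natr1 -[n.+1%:R in X in X -> _]natr1 !addrK => -> ->.
by rewrite factS natrM; ring.
Qed.

Lemma gamma_kernel_linear_integrable (n : nat) (a b : R) :
  mu.-integrable halfline (EFin \o (fun s : R =>
    a * (s `^ n%:R * expR (- s)) + b * (s `^ n.+1%:R * expR (- s)))).
Proof.
have i1 : mu.-integrable halfline (EFin \o (fun s : R => s `^ n%:R * expR (- s))).
  exact: integrable_gamma_kernel.
have i2 : mu.-integrable halfline (EFin \o (fun s : R => s `^ n.+1%:R * expR (- s))).
  exact: integrable_gamma_kernel.
have i1x := integrableZl mhalf a i1.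
have i2x := integrableZl mhalf b i2.
exact: (integrableD mhalf i1x i2x).
Qed.

Let kernel_split (n : nat) (p s : R) : 0 < s ->
  s `^ (n.+1%:R + p - 1) * expR (- s) =
  s `^ p * (s `^ n%:R * expR (- s)).
Proof.
move=> s0; have -> : n.+1%:R + p - 1 = n%:R + p :> R by rewrite -natr1; ring.
by rewrite powRD ?(gt_eqF s0) ?implybT//; ring.
Qed.

Let tangent (n : nat) (s p : R) : (0 < n)%N -> 0 < s ->
  n%:R `^ p * (1 + p * (s / n%:R - 1)) * (s `^ n%:R * expR (- s)) =
  n%:R `^ p * (1 - p) * (s `^ n%:R * expR (- s)) +
  n%:R `^ p * p / n%:R * (s `^ n.+1%:R * expR (- s)).
Proof.
move=> n0 s0; rewrite -[n.+1%:R]natr1 (@powRD _ _ n%:R 1) ?(gt_eqF s0) ?implybT//.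
rewrite powRr1 ?ltW//; field.
by rewrite pnatr_eq0 -lt0n.
Qed.

Let scaled_powR (n : nat) (s p : R) : (0 < n)%N -> 0 < s ->
  s `^ p = n%:R `^ p * (s / n%:R) `^ p.
Proof.
move=> n0 s0; have n0' : (0 : R) < n%:R by rewrite ltr0n.
by rewrite -powRM ?divr_ge0 ?ltW// mulrC divfK ?gt_eqF.
Qed.

(** Integrate the tangent line of [s^p] at [s = n] against [s^n e^(-s)]; this
    weight is concentrated near [n], so little is lost. *)
Lemma Gamma_le_tangent (n : nat) (p : R) : (0 < n)%N -> 0 <= p <= 1 ->
  Gamma (n.+1%:R + p) <= n%:R `^ p * n`!%:R * (1 + p / n%:R).
Proof.
move=> n0 p01; have n0' : (0 : R) < n%:R by rewrite ltr0n.
have -> : n%:R `^ p * n`!%:R * (1 + p / n%:R) =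
    n`!%:R * (n%:R `^ p * (1 - p) + n%:R `^ p * p / n%:R * n.+1%:R).
  by rewrite -natr1; field; rewrite gt_eqF.
rewrite -Gamma_linear GammaE; apply: le_Rintegral => //.
- apply: integrable_gamma_kernel; rewrite -natr1.
  by case/andP: p01 => p0 _; have : (0:R) <= n%:R by []; lra.
- exact: gamma_kernel_linear_integrable.
- move=> s; rewrite /= in_itv/= andbT => s0.
  rewrite (kernel_split n p s0) -tangent// ler_wpM2r ?mulr_ge0 ?powR_ge0 ?expR_ge0//.
  rewrite (scaled_powR _ n0 s0) ler_wpM2l ?powR_ge0//.
  by apply: powR_Bernoulli_le => //; rewrite divr_ge0// ltW.
Qed.

Lemma Gamma_ge_tangent (n : nat) (p : R) : (0 < n)%N -> 1 <= p ->
  n%:R `^ p * n`!%:R * (1 + p / n%:R) <= Gamma (n.+1%:R + p).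
Proof.
move=> n0 p1; have n0' : (0 : R) < n%:R by rewrite ltr0n.
have -> : n%:R `^ p * n`!%:R * (1 + p / n%:R) =
    n`!%:R * (n%:R `^ p * (1 - p) + n%:R `^ p * p / n%:R * n.+1%:R).
  by rewrite -natr1; field; rewrite gt_eqF.
rewrite -Gamma_linear GammaE; apply: le_Rintegral => //.
- exact: gamma_kernel_linear_integrable.
- apply: integrable_gamma_kernel; rewrite -natr1.
  by have : (0:R) <= n%:R by []; lra.
- move=> s; rewrite /= in_itv/= andbT => s0.
  rewrite (kernel_split n p s0) -tangent// ler_wpM2r ?mulr_ge0 ?powR_ge0 ?expR_ge0//.
  rewrite (scaled_powR _ n0 s0) ler_wpM2l ?powR_ge0//.
  by apply: powR_Bernoulli_ge => //; rewrite divr_ge0// ltW.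
Qed.

(** The tangent bound is available for exponents at least 1 and is transferred
    to [p] from [p + 1] by the recursion. *)
Lemma Gamma_ge_powR (n : nat) (p : R) : (0 < n)%N -> 0 <= p ->
  n%:R `^ p * n`!%:R <= Gamma (n.+1%:R + p).
Proof.
move=> n0 p0; have n0' : (0 : R) < n%:R by rewrite ltr0n.
have := @Gamma_ge_tangent n (p + 1) n0; rewrite lerDr => /(_ p0).
rewrite addrA GammaS; last first.
  by rewrite -natr1; have : (0:R) <= n%:R by []; lra.
rewrite powRD ?(gt_eqF n0') ?implybT// powRr1 ?(ltW n0')//.
have -> : n%:R `^ p * n%:R * n`!%:R * (1 + (p + 1) / n%:R) =
    (n.+1%:R + p) * (n%:R `^ p * n`!%:R).
  by rewrite -natr1; field; rewrite gt_eqF.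
by rewrite ler_pM2l// ltr_wpDr.
Qed.

Lemma Gamma_gt0 (x : R) : 1 <= x -> 0 < Gamma x.
Proof.
move=> x1; have x0 : 0 < x by lra.
have := @Gamma_ge_powR 1 (x - 1) isT; rewrite subr_ge0 => /(_ x1).
rewrite powR1 mul1r (_ : 2%:R + (x - 1) = x + 1); last by ring.
rewrite GammaS// => h; rewrite -(pmulr_rgt0 _ x0).
by apply: lt_le_trans h; rewrite ltr0n.
Qed.

End gamma_asymptotics.

(** The coefficient of [z^n] in [(1 - z)^(-c)]. *)
Definition nbin {R : realType} (c : R) (n : nat) : R :=
  \prod_(i < n) ((c + i%:R) / i.+1%:R).

Section nbin.
Context {R : realType}.
Implicit Types (b c p : R) (n k : nat).

Lemma nbin0 c : nbin c 0 = 1. Proof. by rewrite /nbin big_ord0. Qed.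

Lemma nbinS c n : nbin c n.+1 = nbin c n * ((c + n%:R) / n.+1%:R).
Proof. by rewrite /nbin big_ord_recr. Qed.

Lemma nbinSE c n : n.+1%:R * nbin c n.+1 = (c + n%:R) * nbin c n.
Proof. by rewrite nbinS; field; rewrite addrC natr1 pnatr_eq0. Qed.

Lemma nbin_ge0 c n : 0 <= c -> 0 <= nbin c n.
Proof. by move=> c0; apply: prodr_ge0 => i _; rewrite divr_ge0// addr_ge0. Qed.

(** Chu-Vandermonde.  The factor [n + 1 = j + (n + 1 - j)] lets each term of the
    convolution be lowered by [nbinSE]. *)
Lemma nbinD b c n :
  \sum_(j < n.+1) nbin b j * nbin c (n - j)%N = nbin (b + c) n.
Proof.
elim: n => [|n IH]; first by rewrite big_ord1 !nbin0 mulr1.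
apply: (@mulfI _ n.+1%:R); first by rewrite pnatr_eq0.
rewrite nbinSE -IH mulr_sumr.
have -> : \sum_(j < n.+2) n.+1%:R * (nbin b j * nbin c (n.+1 - j)%N) =
  \sum_(j < n.+2) j%:R * nbin b j * nbin c (n.+1 - j)%N +
  \sum_(j < n.+2) nbin b j * ((n.+1 - j)%N%:R * nbin c (n.+1 - j)%N).
  rewrite -big_split/=; apply: eq_bigr => -[j jn] _ /=.
  by rewrite natrB//; ring.
rewrite big_ord_recl/= !mul0r add0r.
rewrite [X in _ + X]big_ord_recr/= subnn mul0r mulr0 addr0 -big_split/=.
rewrite mulr_sumr; apply: eq_bigr => -[j jn] _ /=.
have jn' : (j <= n)%N by rewrite -ltnS.
rewrite /bump/= add1n subSS nbinSE subSn// nbinSE natrB//; ring.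
Qed.

Lemma Gamma_nbin c n : 1 <= c ->
  Gamma (c + n%:R) = Gamma c * n`!%:R * nbin c n.
Proof.
move=> c1; elim: n => [|n IH].
  by rewrite addr0 nbin0 !mulr1.
rewrite -natr1 addrA GammaS; last by rewrite -[leLHS]addr0 lerD.
rewrite IH factS natrM.
have -> : Gamma c * (n.+1%:R * n`!%:R) * nbin c n.+1 =
  Gamma c * n`!%:R * (n.+1%:R * nbin c n.+1) by ring.
by rewrite nbinSE; ring.
Qed.

Lemma nbin_powRE c n : 1 <= c -> (0 < n)%N ->
  nbin c n * n%:R `^ (1 - c) =
  (Gamma c)^-1 * (Gamma (n.+1%:R + (c - 1)) / (n%:R `^ (c - 1) * n`!%:R)).
Proof.
move=> c1 n0; have n0' : (0 : R) < n%:R by rewrite ltr0n.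
have -> : n.+1%:R + (c - 1) = c + n%:R by rewrite -natr1; ring.
rewrite Gamma_nbin// -[1 - c]opprB powRN.
have f0 : (0 : R) < n`!%:R by rewrite ltr0n fact_gt0.
by field; rewrite !gt_eqF ?powR_gt0 ?Gamma_gt0.
Qed.

(** Gauss's formula.  The quotient to be estimated is
    [Gamma (n + 1 + p) / (n^p n!)] with [p = c - 1]; the fractional part of [p]
    is controlled by [Gamma_le_tangent] and its integral part by a quotient of
    factorials. *)
Lemma nbin_powR_cvg c : 1 <= c ->
  (fun n => nbin c n * n%:R `^ (1 - c)) @ \oo --> (Gamma c)^-1.
Proof.
move=> c1; pose p := c - 1; have p0 : 0 <= p by rewrite subr_ge0.
pose j := Num.truncn p; pose th := p - j%:R.
have jp : j%:R <= p by rewrite truncn_le.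
have th0 : 0 <= th by rewrite subr_ge0.
have th1 : th <= 1.
  by rewrite lerBlDl ltW//; have := truncnS_gt p; rewrite -natr1.
pose U (n : nat) := (1 + j%:R * n%:R^-1) `^ p * (1 + n%:R^-1).
have hinv : (fun n : nat => n%:R^-1 : R) @ \oo --> (0:R).
  by apply/cvgrPdist_le => e e0; near=> n;
     rewrite sub0r normrN ger0_norm ?invr_ge0// -[leRHS]invrK lef_pV2 ?posrE ?invr_gt0//;
     [near: n; exact: nbhs_infty_ger|rewrite ltr0n; near: n; exact: nbhs_infty_gt].
have hU : U @ \oo --> (1 : R).
  rewrite -[X in _ --> X](_ : (1 + j%:R * 0) `^ p * (1 + 0) = 1); last first.
    by rewrite mulr0 !addr0 mulr1 powR1.
  have h1 : (fun n : nat => 1 + j%:R * n%:R^-1 : R) @ \oo --> (1 + j%:R * 0 : R).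
    by apply: cvgD; [exact: cvg_cst|exact: cvgMr].
  have h2 : {for (1 + j%:R * 0 : R), continuous (fun s : R => s `^ p)}.
    by apply: continuous_powR; rewrite mulr0 addr0.
  have h3 : (fun n : nat => (1 + j%:R * n%:R^-1 : R) `^ p) @ \oo -->
      (1 + j%:R * 0 : R) `^ p.
    exact: (@cvg_comp _ _ _ _ (fun s : R => s `^ p) _ _ _ h1 h2).
  have h4 : (fun n : nat => 1 + n%:R^-1 : R) @ \oo --> (1 + 0 : R).
    by apply: cvgD => //; exact: cvg_cst.
  exact: cvgM h3 h4.
rewrite -[X in _ --> X]mulr1.
apply: (@cvg_trans _ ((fun n => (Gamma c)^-1 *
   (Gamma (n.+1%:R + p) / (n%:R `^ p * n`!%:R))) @ \oo)).
  apply: near_eq_cvg; near=> n; rewrite nbin_powRE//.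
  by near: n; exact: nbhs_infty_gt.
apply: cvgMr; apply: (@squeeze_cvgr _ _ _ _ (cst 1) U) => //; last exact: cvg_cst.
near=> n.
have n0 : (0 < n)%N by near: n; exact: nbhs_infty_gt.
have n0' : (0 : R) < n%:R by rewrite ltr0n.
have f0 : (0 : R) < n`!%:R by rewrite ltr0n fact_gt0.
apply/andP; split.
  by rewrite ler_pdivlMr ?mulr_gt0 ?powR_gt0// mul1r Gamma_ge_powR.
rewrite ler_pdivrMr ?mulr_gt0 ?powR_gt0//.
pose N := (n + j)%N; have N0 : (0 < N)%N by rewrite addn_gt0 n0.
have N0' : (0 : R) < N%:R by rewrite ltr0n.
have -> : n.+1%:R + p = N.+1%:R + th by rewrite /th /N -!natr1 natrD; ring.
apply: (le_trans (@Gamma_le_tangent _ N th N0 _)); first by rewrite th0.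
have hN : N`!%:R <= N%:R `^ j%:R * n`!%:R :> R.
  rewrite powR_mulrn// /N; elim: (j) => [|i IH]; first by rewrite addn0 expr0 mul1r.
  rewrite addnS factS natrM exprS -mulrA ler_pM//.
  apply: (le_trans IH); rewrite ler_wpM2r// lerXn2r ?nnegrE// ler_nat//.
have -> : U n * (n%:R `^ p * n`!%:R) = N%:R `^ th * (N%:R `^ j%:R * n`!%:R) * (1 + n%:R^-1).
  rewrite /U.
  have -> : 1 + j%:R / n%:R = N%:R / n%:R :> R.
    by rewrite /N natrD; field; rewrite gt_eqF.
  transitivity (((N%:R / n%:R) `^ p * n%:R `^ p) * n`!%:R * (1 + n%:R^-1)).
    by ring.
  rewrite -powRM ?divr_ge0// divfK ?gt_eqF//.
  have -> : N%:R `^ p = N%:R `^ th * N%:R `^ j%:R :> R.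
    by rewrite -powRD ?(gt_eqF N0') ?implybT// /th subrK.
  by ring.
apply: ler_pM; rewrite ?mulr_ge0 ?powR_ge0 ?addr_ge0 ?divr_ge0//.
  by rewrite ler_wpM2l ?powR_ge0.
rewrite lerD2l; apply: (@le_trans _ _ (1 / N%:R)).
  by rewrite ler_wpM2r ?invr_ge0.
by rewrite mul1r lef_pV2 ?posrE// ler_nat leq_addr.
Unshelve. all: by end_near. Qed.

(** Monotonicity in Gauss's formula, from [1 + x <= e^x]; it provides the
    domination that is uniform in [n] when series of such terms are compared
    with their limit. *)
Lemma nbin_powR_noninc c n : 1 <= c -> (0 < n)%N ->
  nbin c n.+1 * n.+1%:R `^ (1 - c) <= nbin c n * n%:R `^ (1 - c).
Proof.
move=> c1 n0; have n0' : (0 : R) < n%:R by rewrite ltr0n.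
have c0 : 0 < c by lra.
rewrite nbinS -mulrA ler_wpM2l ?nbin_ge0 ?(ltW c0)//.
have -> : n%:R `^ (1 - c) = (n%:R / n.+1%:R) `^ (1 - c) * n.+1%:R `^ (1 - c) :> R.
  by rewrite -powRM ?divr_ge0// divfK// pnatr_eq0.
rewrite ler_wpM2r ?powR_ge0//.
have nn : (0:R) < n.+1%:R by rewrite ltr0n.
rewrite -[1 - c]opprB powRN.
rewrite -[leRHS]mul1r ler_pdivlMr ?powR_gt0 ?divr_gt0//.
(* both factors are bounded by exponentials with opposite exponents *)
have h1 : (c + n%:R) / n.+1%:R <= expR ((c - 1) / n.+1%:R).
  have -> : (c + n%:R) / n.+1%:R = 1 + (c - 1) / n.+1%:R.
    by move: nn; rewrite -natr1 => nn; field; rewrite gt_eqF.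
  exact: expR_ge1Dx.
have h2 : (n%:R / n.+1%:R) `^ (c - 1) <= expR (- ((c - 1) / n.+1%:R)).
  have -> : - ((c - 1) / n.+1%:R) = (- n.+1%:R^-1) * (c - 1) by ring.
  rewrite expRM; apply: ge0_ler_powR; rewrite ?nnegrE ?expR_ge0 ?divr_ge0 ?subr_ge0//.
  have -> : n%:R / n.+1%:R = 1 + (- n.+1%:R^-1) :> R.
    by move: nn; rewrite -natr1 => nn; field; rewrite gt_eqF.
  exact: expR_ge1Dx.
apply: (le_trans (ler_pM _ _ h1 h2)).
- by rewrite divr_ge0// addr_ge0// ltW.
- exact: powR_ge0.
- by rewrite -expRD subrr expR0.
Qed.

Lemma nbin_powR_le c n N : 1 <= c -> (0 < N <= n)%N ->
  nbin c n * n%:R `^ (1 - c) <= nbin c N * N%:R `^ (1 - c).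
Proof.
move=> c1 /andP[N0]; elim: n => [|n IH]; first by rewrite leqn0 => /eqP h; rewrite h in N0.
rewrite leq_eqVlt => /predU1P[->//|]; rewrite ltnS => Nn.
apply: le_trans (IH Nn); apply: nbin_powR_noninc => //.
exact: leq_trans Nn.
Qed.

End nbin.

(** * Absolutely summable series and growth of coefficients *)

Section absolutely_summable.
Context {R : realType}.
Implicit Types (a b : nat -> R).

Definition asum a := cvgn (series (fun k => `|a k|)).
Definition ssum a : R := limn (series a).

Lemma asum_cvg a : asum a -> series a @ \oo --> ssum a.
Proof. by move=> h; exact: (normed_cvg h). Qed.

Lemma ssum_eq a l : series a @ \oo --> l -> ssum a = l.
Proof. by move=> h; exact: cvg_lim. Qed.

Lemma eq_ssum a b : a =1 b -> ssum a = ssum b.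
Proof. by move=> /funext ->. Qed.

Lemma asum_le a b : (forall k, `|a k| <= `|b k|) -> asum b -> asum a.
Proof. by move=> ab; apply: series_le_cvg => // k; rewrite ?normr_ge0. Qed.

Lemma asumZ c a : asum a -> asum (fun k => c * a k).
Proof.
move=> ha; rewrite /asum.
have -> : (fun k => `|c * a k|) = `|c| *: (fun k => `|a k|).
  by apply/funext => k; rewrite normrM.
exact: is_cvg_seriesZ.
Qed.

Lemma asumD a b : asum a -> asum b -> asum (fun k => a k + b k).
Proof.
move=> ha hb; apply: (@series_le_cvg _ _ (fun k => `|a k| + `|b k|)).
- by move=> k; exact: normr_ge0.
- by move=> k; rewrite addr_ge0.
- by move=> k; exact: ler_normD.
- exact: is_cvg_seriesD.
Qed.

Lemma asum_sum (I : Type) (r : seq I) (a : I -> nat -> R) :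
  (forall i, asum (a i)) -> asum (fun k => \sum_(i <- r) a i k).
Proof.
move=> h; elim: r => [|i r IH].
  apply: (@asum_le _ (fun k => 0 * 0)).
    by move=> k; rewrite big_nil mulr0.
  apply: asumZ; rewrite /asum; apply/cvg_ex; exists 0.
  rewrite (_ : series _ = cst 0); first exact: cvg_cst.
  by apply/funext => n; rewrite seriesEnat/= big1// => k _; rewrite normr0.
have -> : (fun k => \sum_(j <- i :: r) a j k) = (fun k => a i k + \sum_(j <- r) a j k).
  by apply/funext => k; rewrite big_cons.
exact: asumD.
Qed.

Lemma asum_bounded a (C : R) : (forall n, \sum_(k < n) `|a k| <= C) -> asum a.
Proof.
move=> h; apply: nondecreasing_is_cvgn.
  by apply: nondecreasing_series.
by exists C; move=> _ [n _ <-]; rewrite seriesEord/=; exact: h.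
Qed.

Lemma asum_shift a : asum a -> asum (fun k => a k.+1).
Proof.
move=> h.
apply: (@asum_bounded _ (limn (series (fun k => `|a k|)))) => n.
apply: (@le_trans _ _ (series (fun k => `|a k|) n.+1)).
  by rewrite seriesEord/= big_ord_recl/= lerDr.
apply: nondecreasing_cvgn_le => //; exact: nondecreasing_series.
Qed.

Lemma ssumZ c a : asum a -> ssum (fun k => c * a k) = c * ssum a.
Proof.
move=> h; apply: ssum_eq.
have -> : series (fun k => c * a k) = (fun n => c * series a n).
  by apply/funext => n; rewrite !seriesEord/= mulr_sumr.
by apply: cvgMr; exact: asum_cvg.
Qed.

Lemma ssumD a b : asum a -> asum b -> ssum (fun k => a k + b k) = ssum a + ssum b.
Proof.
move=> ha hb; apply: ssum_eq.
have -> : series (fun k => a k + b k) = (fun n => series a n + series b n).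
  by apply/funext => n; rewrite !seriesEord/= big_split.
by apply: cvgD; exact: asum_cvg.
Qed.

Lemma ssumB a b : asum a -> asum b -> ssum (fun k => a k - b k) = ssum a - ssum b.
Proof.
move=> ha hb; rewrite -mulN1r -ssumZ// -ssumD//; last exact: asumZ.
by apply: eq_ssum => k; rewrite mulN1r.
Qed.

Lemma ssum_sum (I : Type) (r : seq I) (a : I -> nat -> R) :
  (forall i, asum (a i)) ->
  ssum (fun k => \sum_(i <- r) a i k) = \sum_(i <- r) ssum (a i).
Proof.
move=> h; apply: ssum_eq.
have -> : series (fun k => \sum_(i <- r) a i k) =
    (fun n => \sum_(i <- r) series (a i) n).
  by apply/funext => n; rewrite seriesEord/= exchange_big/=; apply: eq_bigr => i _;
     rewrite seriesEord.
elim: r => [|i r IH].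
  by rewrite big_nil; under eq_fun do rewrite big_nil; exact: cvg_cst.
rewrite big_cons; under eq_fun do rewrite big_cons.
by apply: cvgD; [exact: asum_cvg|exact: IH].
Qed.

Lemma ssum_recl a : asum a -> ssum a = a 0%N + ssum (fun k => a k.+1).
Proof.
move=> h; apply: ssum_eq; rewrite -cvg_shiftS/=.
have -> : (fun n => series a n.+1) = (fun n => a 0%N + series (fun k => a k.+1) n).
  by apply/funext => n; rewrite !seriesEord/= big_ord_recl.
by apply: cvgD; [exact: cvg_cst|exact/asum_cvg/asum_shift].
Qed.

Lemma ler_ssum a b : asum a -> asum b -> (forall k, a k <= b k) -> ssum a <= ssum b.
Proof. by move=> ha hb h; apply: lim_series_le => //; exact: normed_cvg. Qed.

Lemma ler_norm_ssum a b : (forall k, `|a k| <= b k) -> asum b ->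
  `|ssum a| <= ssum b.
Proof.
move=> ab hb; have b0 k : 0 <= b k by exact: le_trans (ab k).
have ha : asum a by apply: asum_le hb => k; rewrite (ger0_norm (b0 k)).
rewrite ler_norml; apply/andP; split; last first.
  by apply: ler_ssum => // k; exact: le_trans (ler_norm _) (ab k).
rewrite -mulN1r -ssumZ//; apply: ler_ssum => //; first exact: asumZ.
by move=> k; rewrite mulN1r lerNl; apply: le_trans (ab k); rewrite -normrN ler_norm.
Qed.

Lemma asum_norm a : asum a -> asum (fun k => `|a k|).
Proof. by apply: asum_le => k; rewrite normr_id. Qed.

Lemma series_le_ssum a n : (forall k, 0 <= a k) -> asum a -> \sum_(k < n) a k <= ssum a.
Proof.
move=> a0 ha; have -> : \sum_(k < n) a k = series a n by rewrite seriesEord.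
apply: nondecreasing_cvgn_le; first by apply: nondecreasing_series.
exact: normed_cvg.
Qed.

Lemma asum_tail_cvg a : asum a ->
  (fun n => ssum a - \sum_(k < n) a k) @ \oo --> (0 : R).
Proof.
move=> ha; rewrite -[X in _ --> X](subrr (ssum a)); apply: cvgB; first exact: cvg_cst.
by have := asum_cvg ha; rewrite seriesEord.
Qed.

Lemma ssum_tail_le a b n : (forall k, `|a k| <= b k) -> asum b ->
  `|ssum a - \sum_(k < n) a k| <= ssum b - \sum_(k < n) b k.
Proof.
move=> ab hb; have b0 k : 0 <= b k by exact: le_trans (ab k).
elim: n a b ab hb b0 => [|n IH] a b ab hb b0.
  by rewrite !big_ord0 !subr0; exact: ler_norm_ssum.
have ha : asum a by apply: asum_le hb => k; rewrite (ger0_norm (b0 k)).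
rewrite !big_ord_recl (ssum_recl ha) (ssum_recl hb).
rewrite !opprD !addrA ![_ + _ - _ 0%N]addrAC !subrr !add0r.
by apply: (IH (fun k => a k.+1) (fun k => b k.+1)) => //; exact: asum_shift.
Qed.

End absolutely_summable.

Section coefficient_growth.
Context {R : realType}.
Implicit Types (a b : nat -> R).

(** Coefficients of a power series with radius of convergence at least 1. *)
Definition subgeometric a :=
  forall q : R, 0 <= q < 1 -> exists C, forall k, `|a k| * q ^+ k <= C.

(** Coefficients of an entire function. *)
Definition entire_coef a :=
  forall q : R, 0 <= q -> exists C, forall k, `|a k| * q ^+ k <= C.

Lemma subgeometric_cst (c : R) : subgeometric (fun=> c).
Proof.
move=> q /andP[q0 q1]; exists `|c| => k.
by rewrite ler_piMr// exprn_ile1// ltW.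
Qed.

Lemma subgeometric_nat : subgeometric (fun k => k%:R).
Proof.
move=> q /andP[q0 q1]; exists (1 - q)^-1 => k.
have q1' : 0 < 1 - q by rewrite subr_gt0.
rewrite ger0_norm// -[leRHS]mul1r ler_pdivlMr//.
have : k%:R * q ^+ k * (1 - q) <= 1 - q ^+ k.
  elim: k => [|k IH]; first by rewrite !mul0r expr0 subrr.
  rewrite exprS -natr1.
  have -> : (k%:R + 1) * (q * q ^+ k) * (1 - q) =
    q * (k%:R * q ^+ k * (1 - q)) + q * q ^+ k * (1 - q) by ring.
  have h : q * (k%:R * q ^+ k * (1 - q)) <= q * (1 - q ^+ k) by rewrite ler_wpM2l.
  have qk1 : q ^+ k <= 1 by rewrite exprn_ile1// ltW.
  have qk0 : 0 <= q ^+ k by rewrite exprn_ge0.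
  have h3 : 0 <= (1 - q) * (1 - q * q ^+ k).
    rewrite mulr_ge0 ?subr_ge0 ?(ltW q1)// mulr_ile1// ltW//.
  lra.
by move/le_trans; apply; rewrite gerBl exprn_ge0.
Qed.

Lemma subgeometricD a b : subgeometric a -> subgeometric b ->
  subgeometric (fun k => a k + b k).
Proof.
move=> ha hb q q01; have [C hC] := ha q q01; have [C' hC'] := hb q q01.
exists (C + C') => k; apply: le_trans (lerD (hC k) (hC' k)).
rewrite -mulrDl ler_wpM2r ?ler_normD// exprn_ge0//.
by case/andP: q01.
Qed.

Lemma subgeometricM a b : subgeometric a -> subgeometric b ->
  subgeometric (fun k => a k * b k).
Proof.
move=> ha hb q /andP[q0 q1]; pose s := Num.sqrt q.
have s01 : 0 <= s < 1 by rewrite sqrtr_ge0/= -sqrtr1 ltr_sqrt.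
have [C hC] := ha s s01; have [C' hC'] := hb s s01.
exists (C * C') => k.
have -> : `|a k * b k| * q ^+ k = (`|a k| * s ^+ k) * (`|b k| * s ^+ k).
  have -> : q = s * s by rewrite -expr2 sqr_sqrtr.
  by rewrite normrM exprMn; ring.
by apply: ler_pM => //; rewrite mulr_ge0// exprn_ge0//; case/andP: s01.
Qed.

Lemma subgeometricX i a : subgeometric a -> subgeometric (fun k => a k ^+ i).
Proof.
move=> ha; elim: i => [|i IH]; first exact: (subgeometric_cst 1).
by under eq_fun do rewrite exprS; exact: subgeometricM.
Qed.

Lemma entire_coefM a b : entire_coef a -> subgeometric b ->
  entire_coef (fun k => b k * a k).
Proof.
move=> ha hb q q0.
have [|C hC] := ha (2 * q); first by rewrite mulr_ge0.
have [|C' hC'] := hb (1 / 2); first by apply/andP; split; lra.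
exists (C' * C) => k.
have -> : `|b k * a k| * q ^+ k = (`|b k| * (1 / 2) ^+ k) * (`|a k| * (2 * q) ^+ k).
  by rewrite normrM -[q in LHS](_ : 1 / 2 * (2 * q) = q) ?exprMn//; [ring|field].
by apply: ler_pM => //; rewrite mulr_ge0// exprn_ge0// ?mulr_ge0//; lra.
Qed.

Lemma asum_geometric (C q : R) : 0 <= q < 1 -> asum (fun k => C * q ^+ k).
Proof.
move=> /andP[q0 q1]; apply: asumZ; rewrite /asum.
rewrite (_ : (fun k => `|q ^+ k|) = geometric 1 q); last first.
  by apply/funext => k; rewrite ger0_norm ?exprn_ge0//= mul1r.
by apply: is_cvg_geometric_series; rewrite ger0_norm.
Qed.

Lemma asum_subgeometric a (x : R) : subgeometric a -> `|x| < 1 ->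
  asum (fun k => a k * x ^+ k).
Proof.
move=> ha x1; pose s := Num.sqrt `|x|.
have s01 : 0 <= s < 1 by rewrite sqrtr_ge0/= -sqrtr1 ltr_sqrt.
have [C hC] := ha s s01.
apply: (@asum_le _ _ (fun k => C * s ^+ k)); last exact: asum_geometric.
move=> k.
have -> : `|a k * x ^+ k| = (`|a k| * s ^+ k) * s ^+ k.
  have xs : `|x| = s * s by rewrite -expr2 sqr_sqrtr.
  by rewrite normrM normrX xs exprMn mulrA.
rewrite [leRHS]normrM [X in _ <= _ * X]ger0_norm ?exprn_ge0 ?(proj1 (andP s01))//.
rewrite ler_wpM2r ?exprn_ge0 ?(proj1 (andP s01))//.
exact: le_trans (hC k) (ler_norm _).
Qed.

Lemma asum_entire a (x : R) : entire_coef a -> asum (fun k => a k * x ^+ k).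
Proof.
move=> ha; have [|C hC] := ha (2 * `|x|); first by rewrite mulr_ge0.
have h01 : 0 <= 1 / 2 :> R /\ 1 / 2 < 1 :> R by split; lra.
apply: (@asum_le _ _ (fun k => C * (1 / 2) ^+ k)); last first.
  by apply: asum_geometric; apply/andP.
move=> k.
have -> : `|a k * x ^+ k| = (`|a k| * (2 * `|x|) ^+ k) * (1 / 2) ^+ k.
  rewrite -mulrA -exprMn normrM normrX; congr (_ * _ ^+ _).
  by field.
rewrite [leRHS]normrM [X in _ <= _ * X]ger0_norm ?exprn_ge0//.
rewrite ler_wpM2r ?exprn_ge0//.
exact: le_trans (hC k) (ler_norm _).
Qed.

End coefficient_growth.

(** * The reciprocal of the Gamma function *)

(** The entire function extending [1 / Gamma]: the argument is moved into
    [[1, +oo[], where the integral is used, and brought back by the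
    recursion; how far it is moved is immaterial ([rgammaE]). *)
Definition rgamma {R : realType} (b : R) : R :=
  let m := (Num.truncn `|b|).+2 in
  (\prod_(i < m) (b + i%:R)) / Gamma (b + m%:R).

Section rgamma.
Context {R : realType}.
Implicit Types (b : R).

Let rg m b : R := (\prod_(i < m) (b + i%:R)) / Gamma (b + m%:R).

Let rgS m b : 1 <= b + m%:R -> rg m.+1 b = rg m b.
Proof.
move=> h; rewrite /rg big_ord_recr/= -natr1 addrA GammaS//.
have G0 := Gamma_gt0 h; field.
by rewrite !gt_eqF//; lra.
Qed.

Lemma rgammaE m b : 1 <= b + m%:R ->
  rgamma b = (\prod_(i < m) (b + i%:R)) / Gamma (b + m%:R).
Proof.
have key m1 m2 : (m1 <= m2)%N -> 1 <= b + m1%:R -> rg m2 b = rg m1 b.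
  move=> /subnKC <- h; elim: (m2 - m1)%N => [|i IH]; first by rewrite addn0.
  rewrite addnS rgS; [exact: IH|rewrite natrD; have := ler0n R i; lra].
move=> h; rewrite /rgamma -/(rg _ b) -/(rg _ b).
set m0 := _.+2; have h0 : 1 <= b + m0%:R.
  have := @truncnS_gt R `|b|; rewrite /m0 -natr1.
  by have := ler_norm (- b); rewrite normrN; lra.
by have [/key->|/ltnW/key <-] := leqP m m0.
Qed.

Lemma rgamma_inv b : 1 <= b -> rgamma b = (Gamma b)^-1.
Proof. by move=> b1; rewrite (@rgammaE 0) ?addr0// big_ord0 mul1r. Qed.

Lemma rgamma_rec b : rgamma b = b * rgamma (b + 1).
Proof.
pose m := (Num.truncn `|b|).+2; have h0 : 1 <= b + m%:R.
  have := @truncnS_gt R `|b|; rewrite /m -natr1.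
  by have := ler_norm (- b); rewrite normrN; lra.
rewrite (@rgammaE m.+1 b); last by rewrite -natr1 addrA; lra.
rewrite (@rgammaE m (b + 1)); last by rewrite -addrA addrCA; lra.
rewrite big_ord_recl/= addr0 mulrA; congr (_ * _ / Gamma _).
  by apply: eq_bigr => i _; rewrite /bump/= add1n -natr1; ring.
by rewrite -natr1; ring.
Qed.

Lemma rgamma_gt0 b : 1 <= b -> 0 < rgamma b.
Proof. by move=> b1; rewrite rgamma_inv// invr_gt0 Gamma_gt0. Qed.

Lemma rgamma_neq0 b : (forall i : nat, b != - i%:R) -> rgamma b != 0.
Proof.
move=> h; pose m := (Num.truncn `|b|).+2; have h0 : 1 <= b + m%:R.
  have := @truncnS_gt R `|b|; rewrite /m -natr1.
  by have := ler_norm (- b); rewrite normrN; lra.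
rewrite (rgammaE h0) mulf_neq0 ?invr_eq0 ?(gt_eqF (Gamma_gt0 h0))//.
by apply/prodf_neq0 => i _; rewrite addr_eq0.
Qed.

Lemma rgamma_cvg (c : R) : 1 <= c ->
  (fun n => nbin c n * n%:R `^ (1 - c)) @ \oo --> rgamma c.
Proof. by move=> c1; rewrite rgamma_inv//; exact: nbin_powR_cvg. Qed.

Lemma rgamma_le (c : R) N : 1 <= c -> (0 < N)%N ->
  rgamma c <= nbin c N * N%:R `^ (1 - c).
Proof.
move=> c1 N0; rewrite -(cvg_lim _ (rgamma_cvg c1))//.
apply: limr_le; first by apply/cvg_ex; eexists; exact: rgamma_cvg.
near=> n; apply: nbin_powR_le => //; rewrite N0/=.
by near: n; exact: nbhs_infty_ge.
Unshelve. all: by end_near. Qed.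

Variable (beta : R).
Hypothesis beta_gt0 : 0 < beta.

Lemma subgeometric_nbin (b : R) n : subgeometric (fun k => nbin (beta * k%:R + b) n).
Proof.
elim: n => [|n IH].
  by under eq_fun do rewrite nbin0; exact: subgeometric_cst.
under eq_fun do rewrite nbinS.
apply: subgeometricM => //; apply: subgeometricM; last exact: subgeometric_cst.
apply: subgeometricD; last exact: subgeometric_cst.
apply: subgeometricD; last exact: subgeometric_cst.
by apply: subgeometricM; [exact: subgeometric_cst|exact: subgeometric_nat].
Qed.

Lemma ge1_betab (b : R) k : 1 <= b -> 1 <= beta * k%:R + b.
Proof. by move=> b1; apply: (le_trans b1); rewrite lerDr mulr_ge0// ltW. Qed.

Lemma powR_affine (N : nat) (b : R) k : (0 < N)%N ->
  N%:R `^ (1 - (beta * k%:R + b)) = N%:R `^ (1 - b) * (N%:R `^ (- beta)) ^+ k :> R.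
Proof.
move=> N0; have N0' : (0 : R) < N%:R by rewrite ltr0n.
rewrite -powR_mulrn ?powR_ge0// -powRrM -powRD ?(gt_eqF N0') ?implybT//.
by congr (_ `^ _); ring.
Qed.

Lemma powR_nat_unbounded (q : R) : exists2 N : nat, (0 < N)%N & q < N%:R `^ beta.
Proof.
pose N := (Num.truncn ((`|q| + 1) `^ beta^-1)).+1; exists N => //.
have hN : (`|q| + 1) `^ beta^-1 <= N%:R by exact/ltW/truncnS_gt.
have := @ge0_ler_powR R beta (ltW beta_gt0) _ _ (powR_ge0 _ _) (ler0n _ N) hN.
rewrite -powRrM mulVf ?gt_eqF// powRr1; last by rewrite addr_ge0.
by have := ler_norm q; lra.
Qed.

(** For arguments at least 1, [rgamma_le] bounds the coefficients by
    [N^(- beta k)] up to a subgeometric factor, with [N^beta] as large as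
    desired.  Each step down in [b] costs a factor linear in [k]. *)
Lemma entire_rgamma (b : R) : entire_coef (fun k => rgamma (beta * k%:R + b)).
Proof.
have [n bn] : exists n : nat, 1 <= b + n%:R.
  exists (Num.truncn `|b|).+2.
  have := @truncnS_gt R `|b|; rewrite -natr1.
  by have := ler_norm (- b); rewrite normrN; lra.
elim: n b bn => [|n IH] b bn; last first.
  under eq_fun do rewrite rgamma_rec.
  apply: entire_coefM.
    under eq_fun do rewrite -addrA.
    by apply: IH; move: bn; rewrite -natr1; lra.
  apply: subgeometricD; last exact: subgeometric_cst.
  by apply: subgeometricM; [exact: subgeometric_cst|exact: subgeometric_nat].
move: bn; rewrite addr0 => b1 q q0.
have [N N0 Nq] := powR_nat_unbounded q.
have N0' : (0 : R) < N%:R by rewrite ltr0n.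
have qN : 0 <= q * N%:R `^ (- beta) < 1.
  by rewrite mulr_ge0 ?powR_ge0//= powRN ltr_pdivrMr ?powR_gt0// mul1r.
have [C hC] := @subgeometric_nbin b N _ qN.
exists (N%:R `^ (1 - b) * C) => k.
have c1 := @ge1_betab b k b1.
have g0 := rgamma_gt0 c1; rewrite (ger0_norm (ltW g0)).
apply: (@le_trans _ _ (N%:R `^ (1 - b) *
    (`|nbin (beta * k%:R + b) N| * (q * N%:R `^ (- beta)) ^+ k))); last first.
  by rewrite ler_wpM2l ?powR_ge0.
rewrite ger0_norm ?nbin_ge0//; last by lra.
have := rgamma_le c1 N0; rewrite powR_affine// => h.
apply: (le_trans (ler_wpM2r (exprn_ge0 k q0) h)).
by rewrite exprMn le_eqVlt; apply/orP; left; apply/eqP; ring.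
Qed.

End rgamma.

#[global] Opaque rgamma.

(** * A maximum principle for the Mittag-Leffler function *)

Section resolvent_bound.
Context {R : realType}.
Variables (beta b : R).
Hypothesis beta01 : 0 < beta < 1.
Hypothesis b1 : 1 <= b.

Let beta0 : 0 < beta. Proof. by case/andP: beta01. Qed.

Lemma nbinN_le0 n : nbin (- beta) n.+1 <= 0.
Proof.
have beta1 : beta < 1 by case/andP: beta01.
elim: n => [|n IH].
  by rewrite nbinS nbin0 mul1r addr0 divr1 oppr_le0 ltW.
rewrite nbinS mulr_le0_ge0// divr_ge0//.
have : (1 : R) <= n.+1%:R by rewrite ler1n.
lra.
Qed.

Let G n i (m : R) : R :=
  ssum (fun k => nbin (beta * k%:R + b) n * k%:R ^+ i * (- m) ^+ k).

Let asumG n i (m : R) : 0 <= m < 1 ->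
  asum (fun k => nbin (beta * k%:R + b) n * k%:R ^+ i * (- m) ^+ k).
Proof.
move=> /andP[m0 m1]; apply: asum_subgeometric; last by rewrite normrN ger0_norm.
apply: subgeometricM; first exact: subgeometric_nbin.
exact/subgeometricX/subgeometric_nat.
Qed.

(** The series [G n 0 m] is the coefficient of [z^n] in
    [(1 - z)^(beta - b) / ((1 - z)^beta + m)]; multiply by the denominator and
    apply [(m d/dm)^i]. *)
Let G_rec n i (m : R) : 0 <= m < 1 ->
  \sum_(j < n.+1) nbin (- beta) j * G (n - j)%N i m =
  (i == 0)%:R * nbin (b - beta) n - m * \sum_(l < i.+1) 'C(i, l)%:R * G n l m.
Proof.
move=> m01; have hA n' i' := @asumG n' i' _ m01.
transitivity (ssum (fun k => nbin (beta * k%:R + b - beta) n * k%:R ^+ i * (- m) ^+ k)).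
  under eq_bigr do rewrite -ssumZ//.
  rewrite -ssum_sum; last by move=> j; exact: asumZ.
  congr ssum; apply/funext => k.
  under eq_bigr do rewrite -mulrA mulrA.
  by rewrite -mulr_suml nbinD addrC mulrA.
have hA2 : asum (fun k => nbin (beta * k%:R + b - beta) n * k%:R ^+ i * (- m) ^+ k).
  apply: asum_subgeometric; last first.
    by case/andP: m01 => m0 m1; rewrite normrN ger0_norm.
  apply: subgeometricM; last exact/subgeometricX/subgeometric_nat.
  under eq_fun do rewrite -addrA.
  exact: subgeometric_nbin.
rewrite ssum_recl// mulr0 add0r expr0 mulr1 expr0n mulrC; congr (_ + _).
have -> : (fun k => nbin (beta * k.+1%:R + b - beta) n * k.+1%:R ^+ i * (- m) ^+ k.+1) =
  (fun k => - m * \sum_(l < i.+1) 'C(i, l)%:R *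
     (nbin (beta * k%:R + b) n * k%:R ^+ l * (- m) ^+ k)).
  apply/funext => k.
  have -> : beta * k.+1%:R + b - beta = beta * k%:R + b by rewrite -natr1; ring.
  rewrite -[k.+1]add1n natrD exprDn exprD expr1 mulr_sumr mulr_suml mulr_sumr.
  apply: eq_bigr => l _; rewrite expr1n mul1r -mulr_natl; ring.
rewrite ssumZ; last by apply: asum_sum => l; exact: asumZ.
rewrite mulNr ssum_sum; last by move=> l; exact: asumZ.
by congr (- (_ * _)); apply: eq_bigr => l _; rewrite ssumZ.
Qed.

Let sum_bin_fact i :
  \sum_(l < i) 'C(i, l)%:R * (l`!%:R * 2 ^+ l) <= i`!%:R * 2 ^+ i :> R.
Proof.
apply: (@le_trans _ _ (\sum_(l < i) i`!%:R * 2 ^+ l)).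
  apply: ler_sum => l _; rewrite mulrA ler_wpM2r ?exprn_ge0// -natrM ler_nat.
  have li : (l <= i)%N by exact: ltnW.
  by rewrite -(bin_fact li) leq_mul2l leq_pmulr ?fact_gt0// orbT.
rewrite -mulr_sumr ler_wpM2l//; elim: i => [|i IH]; first by rewrite big_ord0 expr0.
by rewrite big_ord_recr/= exprS; lra.
Qed.

(** Since [nbin (- beta) j <= 0] for [j >= 1], the recursion expresses
    [(1 + m) G n i m] through earlier terms with nonnegative weights, and
    [nbin b n] solves it with [m = 0], so it is a supersolution.  With [i! 2^i]
    the terms of lower order in [i], which come with the factor [m], are
    absorbed by the [1 + m] on the left. *)
Let G_bound n i (m : R) : 0 <= m < 1 -> `|G n i m| <= i`!%:R * 2 ^+ i * nbin b n.
Proof.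
move=> m01; have /andP[m0 m1] := m01.
have bb0 : 0 <= b - beta.
  by rewrite subr_ge0 (le_trans _ b1)// ltW//; case/andP: beta01.
have b0 : 0 <= b by exact: le_trans b1.
elim/ltn_ind: i n => i IHi; elim/ltn_ind => n IHn.
set B := i`!%:R * 2 ^+ i.
have B1 : 1 <= B.
  by rewrite /B -natrX -natrM ler1n muln_gt0 fact_gt0 expn_gt0.
have := G_rec n i m01; rewrite big_ord_recl nbin0 mul1r subn0.
rewrite big_ord_recr/= binn mul1r.
set S := \sum_(j < n) _; set L := \sum_(l < i) _ => hG.
have hS : `|S| <= B * (nbin b n - nbin (b - beta) n).
  have := nbinD (- beta) b n; rewrite big_ord_recl nbin0 mul1r subn0 addrC.
  rewrite (addrC (- beta)) => <-; rewrite opprD addrCA subrr addr0 -sumrN mulr_sumr.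
  apply: (le_trans (ler_norm_sum _ _ _)); apply: ler_sum => j _.
  have hj := nbinN_le0 j.
  rewrite /bump/= add1n normrM ler0_norm// -mulNr mulrCA ler_wpM2l ?oppr_ge0//.
  apply: IHn; rewrite ltn_subrL/=.
  exact: leq_ltn_trans (ltn_ord j).
have hL : `|L| <= B * nbin b n.
  apply: (le_trans (ler_norm_sum _ _ _)).
  apply: (@le_trans _ _ (\sum_(l < i) 'C(i, l)%:R * (l`!%:R * 2 ^+ l) * nbin b n)).
    apply: ler_sum => l _; rewrite normrM ger0_norm// -mulrA ler_wpM2l//.
    exact: IHi.
  by rewrite -mulr_suml ler_wpM2r ?nbin_ge0// sum_bin_fact.
have hp : `|(i == 0)%:R * nbin (b - beta) n| <= B * nbin (b - beta) n.
  have p0 := nbin_ge0 n bb0.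
  rewrite normrM (ger0_norm p0) ler_wpM2r//.
  by case: eqP => _; rewrite ?normr1 ?normr0//; lra.
have hmain : (1 + m) * `|G n i m| <= (1 + m) * (B * nbin b n).
  rewrite -[X in X * `|_|]ger0_norm; last by lra.
  rewrite -normrM.
  have -> : (1 + m) * G n i m = (i == 0)%:R * nbin (b - beta) n - S - m * L.
    by move: hG; lra.
  apply: (le_trans (ler_normB _ _)); rewrite (mulrDl 1 m) mul1r.
  apply: lerD; last by rewrite normrM ger0_norm// ler_wpM2l.
  apply: (le_trans (ler_normB _ _)); move: hS hp; rewrite mulrBr; lra.
by move: hmain; rewrite ler_pM2l//; lra.
Qed.

(** Dominates, uniformly in [n >= N], the terms that tend to those of the
    Mittag-Leffler series. *)
Let majorant N i x k : R :=
  nbin (beta * k%:R + b) N * k%:R ^+ i * (x * N%:R `^ (- beta)) ^+ k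
  * N%:R `^ (1 - b).

Let ML_theta_partial_bound i (x : R) : 0 < x -> forall K : nat, forall N : nat,
  (0 < N)%N -> x < N%:R `^ beta ->
  `| \sum_(k < K) rgamma (beta * k%:R + b) * k%:R ^+ i * (- x) ^+ k | <=
  i`!%:R * 2 ^+ i * rgamma b + (ssum (majorant N i x) - \sum_(k < K) majorant N i x k).
Proof.
move=> x0 K N N0 Nx; set dom := majorant N i x.
have N0' : (0 : R) < N%:R by rewrite ltr0n.
pose u n k := nbin (beta * k%:R + b) n * k%:R ^+ i * (- (x * n%:R `^ (- beta))) ^+ k
               * n%:R `^ (1 - b).
have uE n k : (0 < n)%N -> u n k = nbin (beta * k%:R + b) n *
     n%:R `^ (1 - (beta * k%:R + b)) * k%:R ^+ i * (- x) ^+ k.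
  by move=> n0; rewrite /u powR_affine// -mulNr exprMn; ring.
have mn n : (N <= n)%N -> 0 <= x * n%:R `^ (- beta) < 1.
  move=> Nn; rewrite mulr_ge0 ?powR_ge0 ?(ltW x0)//= powRN.
  have n0 : (0 : R) < n%:R by rewrite ltr0n; exact: leq_trans Nn.
  rewrite ltr_pdivrMr ?powR_gt0// mul1r (lt_le_trans Nx)//.
  by rewrite ge0_ler_powR ?nnegrE ?(ltW beta0)// ler_nat.
have uD n k : (N <= n)%N -> `|u n k| <= dom k.
  move=> Nn; have n0 : (0 < n)%N by exact: leq_trans Nn.
  have c1 := ge1_betab beta0 k b1.
  rewrite uE// /dom /majorant -(mulrA _ _ (N%:R `^ _)) -(mulrC (N%:R `^ _)) exprMn.
  rewrite !normrM !normrX normrN normr_nat (gtr0_norm x0) (ger0_norm (powR_ge0 _ _)).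
  rewrite ger0_norm; last by apply: nbin_ge0; exact: le_trans c1.
  have := @nbin_powR_le R _ n N c1; rewrite N0 Nn => /(_ isT).
  rewrite [X in _ <= _ * X]powR_affine// => h.
  have -> : nbin (beta * k%:R + b) N * k%:R ^+ i *
     (N%:R `^ (1 - b) * (x ^+ k * N%:R `^ (- beta) ^+ k)) =
     nbin (beta * k%:R + b) N * (N%:R `^ (1 - b) * N%:R `^ (- beta) ^+ k) *
     k%:R ^+ i * x ^+ k by ring.
  by do 2 (apply: ler_wpM2r; first by rewrite exprn_ge0 ?(ltW x0)).
have asD : asum dom.
  rewrite /dom /majorant.
  under eq_fun do rewrite mulrC.
  apply: asumZ; apply: asum_subgeometric.
    apply: subgeometricM; first exact: subgeometric_nbin.
    exact/subgeometricX/subgeometric_nat.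
  by have /andP[h0 h1] := mn N (leqnn _); rewrite ger0_norm.
have partial n : (N <= n)%N -> `|\sum_(k < K) u n k| <=
    i`!%:R * 2 ^+ i * (nbin b n * n%:R `^ (1 - b)) + (ssum dom - \sum_(k < K) dom k).
  move=> Nn.
  have -> : \sum_(k < K) u n k = ssum (u n) - (ssum (u n) - \sum_(k < K) u n k) by ring.
  apply: (le_trans (ler_normB _ _)); apply: lerD; last first.
    by apply: ssum_tail_le => // k; exact: uD.
  rewrite /u; under [X in ssum X]eq_fun do rewrite mulrC.
  rewrite ssumZ; last by apply: asumG; exact: mn.
  rewrite -/(G n i _) normrM (ger0_norm (powR_ge0 _ _)) mulrC mulrA.
  by rewrite ler_wpM2r ?powR_ge0//; apply: G_bound; exact: mn.
(* for fixed K both sides pass to the limit n -> oo by Gauss's formula *)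
have cl : (fun n => `|\sum_(k < K) u n k|) @ \oo -->
    `| \sum_(k < K) rgamma (beta * k%:R + b) * k%:R ^+ i * (- x) ^+ k |.
  apply: cvg_norm; apply: (@cvg_big _ _ +%R 0 _ add_continuous) => k _.
  apply: (@cvg_trans _ ((fun n => nbin (beta * k%:R + b) n *
     n%:R `^ (1 - (beta * k%:R + b)) * k%:R ^+ i * (- x) ^+ k) @ \oo)).
    by apply: near_eq_cvg; near=> n; rewrite uE//; near: n; exact: nbhs_infty_gt.
  do 2 apply: cvgMl; apply: rgamma_cvg.
  exact: ge1_betab.
have cr : (fun n => i`!%:R * 2 ^+ i * (nbin b n * n%:R `^ (1 - b)) +
     (ssum dom - \sum_(k < K) dom k)) @ \oo -->
    i`!%:R * 2 ^+ i * rgamma b + (ssum dom - \sum_(k < K) dom k).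
  by apply: cvgD; [apply: cvgMr; exact: rgamma_cvg|exact: cvg_cst].
apply: (ler_cvg_to cl cr); near=> n; apply: partial.
by near: n; exact: nbhs_infty_ge.
Unshelve. all: by end_near. Qed.

Lemma ML_theta_bound_ge1 i (x : R) : 0 < x ->
  `|ssum (fun k => rgamma (beta * k%:R + b) * k%:R ^+ i * (- x) ^+ k)| <=
  i`!%:R * 2 ^+ i * rgamma b.
Proof.
move=> x0; have [N N0 Nx] := powR_nat_unbounded beta0 x.
have N0' : (0 : R) < N%:R by rewrite ltr0n.
have asD : asum (majorant N i x).
  rewrite /majorant; under eq_fun do rewrite mulrC.
  apply: asumZ; apply: asum_subgeometric.
    apply: subgeometricM; first exact: subgeometric_nbin.
    exact/subgeometricX/subgeometric_nat.
  rewrite ger0_norm ?mulr_ge0 ?powR_ge0 ?(ltW x0)// powRN.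
  by rewrite ltr_pdivrMr ?powR_gt0// mul1r.
set a := fun k => _.
have asa : asum a.
  apply: asum_entire.
  under eq_fun do rewrite mulrC.
  apply: entire_coefM; first exact: entire_rgamma.
  exact/subgeometricX/subgeometric_nat.
have ca : (fun K => `|\sum_(k < K) a k|) @ \oo --> `|ssum a|.
  by apply: cvg_norm; have := asum_cvg asa; rewrite seriesEord.
have cD : (fun K => i`!%:R * 2 ^+ i * rgamma b + (ssum (majorant N i x) - \sum_(k < K) majorant N i x k)) @ \oo -->
    i`!%:R * 2 ^+ i * rgamma b + 0.
  by apply: cvgD; [exact: cvg_cst|exact: asum_tail_cvg].
rewrite -[leRHS]addr0; apply: (ler_cvg_to ca cD).
by apply: nearW => K; exact: ML_theta_partial_bound.
Qed.

End resolvent_bound.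

(** * Mittag-Leffler functions on the negative half-line *)

Section ML_theta.
Context {R : realType}.
Variable beta : R.
Hypothesis beta01 : 0 < beta < 1.

Let beta0 : 0 < beta. Proof. by case/andP: beta01. Qed.

(** The [i]-th iterate of [x d/dx] applied to [E_(beta,b)(-x)]; working with the
    coefficients makes differentiation of series unnecessary. *)
Definition ML_theta (beta b : R) (i : nat) (x : R) : R :=
  ssum (fun k => rgamma (beta * k%:R + b) * k%:R ^+ i * (- x) ^+ k).

Definition ML (beta b x : R) : R := ML_theta beta b 0 x.

Lemma entire_rgammaM (b : R) (p : nat -> R) : subgeometric p ->
  entire_coef (fun k => rgamma (beta * k%:R + b) * p k).
Proof.
by move=> hp; under eq_fun do rewrite mulrC; apply: entire_coefM => //;
  exact: entire_rgamma.
Qed.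

Lemma asum_ML (b : R) (p : nat -> R) (x : R) : subgeometric p ->
  asum (fun k => rgamma (beta * k%:R + b) * p k * x ^+ k).
Proof. by move=> hp; apply: asum_entire; exact: entire_rgammaM. Qed.

Lemma asum_ML_theta b i x :
  asum (fun k => rgamma (beta * k%:R + b) * k%:R ^+ i * (- x) ^+ k).
Proof. by apply: asum_ML; exact/subgeometricX/subgeometric_nat. Qed.

Lemma ML_theta_pred b i x :
  ML_theta beta (b - 1) i x = (b - 1) * ML_theta beta b i x + beta * ML_theta beta b i.+1 x.
Proof.
rewrite /ML_theta -!ssumZ; try exact: asum_ML_theta.
rewrite -ssumD; try by apply: asumZ; exact: asum_ML_theta.
congr ssum; apply/funext => k.
rewrite rgamma_rec (_ : beta * k%:R + (b - 1) + 1 = beta * k%:R + b); last by ring.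
by rewrite exprS; ring.
Qed.

(** Lowering [b] by 1 costs one more Euler derivative, which multiplies the
    bound by a geometric factor in [i]. *)
Lemma ML_theta_bound (b : R) : exists C r : R, [/\ 0 <= C, 1 <= r &
  forall i (x : R), 0 < x -> `|ML_theta beta b i x| <= C * i`!%:R * r ^+ i].
Proof.
have [n bn] : exists n : nat, 1 <= b + n%:R.
  exists (Num.truncn `|b|).+2.
  have := @truncnS_gt R `|b|; rewrite -natr1.
  by have := ler_norm (- b); rewrite normrN; lra.
elim: n b bn => [|n IH] b bn.
  rewrite addr0 in bn; exists (rgamma b), 2; split; [exact/ltW/rgamma_gt0|lra|].
  move=> i x x0; apply: (le_trans (ML_theta_bound_ge1 beta01 bn i x0)).
  by rewrite le_eqVlt; apply/orP; left; apply/eqP; ring.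
have [|C [r [C0 r1 h]]] := IH (b + 1); first by move: bn; rewrite -natr1; lra.
have r0 : 0 <= r by exact: le_trans r1.
exists (C * (`|b| + beta * r)), (2 * r).
have br0 : 0 <= `|b| + beta * r by rewrite addr_ge0// mulr_ge0// ltW.
split; [by rewrite mulr_ge0|by lra|].
move=> i x x0; have := ML_theta_pred (b + 1) i x; rewrite addrK => ->.
apply: (le_trans (ler_normD _ _)); rewrite !normrM (gtr0_norm beta0).
have h1 := h i x x0; have h2 := h i.+1 x x0.
set P := C * i`!%:R * r ^+ i; have P0 : 0 <= P by rewrite !mulr_ge0// exprn_ge0.
have h1' : `|b| * `|ML_theta beta (b + 1) i x| <= `|b| * (P * 2 ^+ i).
  rewrite ler_wpM2l// (le_trans h1)//.
  by rewrite -[leLHS]mulr1 ler_wpM2l// exprn_ege1//; lra.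
have h2' : beta * `|ML_theta beta (b + 1) i.+1 x| <= beta * (r * (P * 2 ^+ i)).
  rewrite ler_wpM2l ?(ltW beta0)// (le_trans h2)//.
  have -> : C * i.+1`!%:R * r ^+ i.+1 = r * (P * i.+1%:R).
    by rewrite /P factS natrM exprS; ring.
  rewrite ler_wpM2l// ler_wpM2l// -natrX ler_nat; exact: ltn_expl.
apply: (le_trans (lerD h1' h2')); rewrite exprMn /P le_eqVlt; apply/orP; left.
by apply/eqP; ring.
Qed.

(** The Euler derivatives of [x^(-s) E_(beta,b)(-x)], multiplied by [x^s]: the
    factor [x^(-s)] replaces [k] by [k - s] in the coefficients. *)
Lemma ML_theta_shift_bound (b : R) (s : nat) : exists C r : R, [/\ 0 <= C, 1 <= r &
  forall i (x : R), 0 < x ->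
  `|ssum (fun k => rgamma (beta * k%:R + b) * (k%:R - s%:R) ^+ i * (- x) ^+ k)|
    <= C * i`!%:R * r ^+ i].
Proof.
have [C [r [C0 r1 h]]] := ML_theta_bound b.
pose q := r + s%:R; have r0 : 0 <= r by lra.
have q1 : 1 <= q by rewrite /q; have := ler0n R s; lra.
have q0 : 0 <= q by lra.
have sq : s%:R <= q by rewrite /q lerDr.
have rq : r <= q by rewrite /q lerDl.
exists C, (q + q); split => //; first by lra.
move=> i x x0.
have -> : (fun k : nat => rgamma (beta * k%:R + b) * (k%:R - s%:R) ^+ i * (- x) ^+ k) =
  (fun k : nat => \sum_(l < i.+1) ((- s%:R) ^+ (i - l) *+ 'C(i, l)) *
    (rgamma (beta * k%:R + b) * k%:R ^+ l * (- x) ^+ k)).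
  apply/funext => k; rewrite (addrC k%:R) exprDn mulr_sumr mulr_suml.
  by apply: eq_bigr => l _; rewrite !mulrnAr !mulrnAl; congr (_ *+ _); ring.
rewrite ssum_sum; last by move=> l; apply: asumZ; exact: asum_ML_theta.
under eq_bigr => l _ do (rewrite ssumZ; [|exact: asum_ML_theta]).
apply: (le_trans (ler_norm_sum _ _ _)).
rewrite exprDn mulr_sumr; apply: ler_sum => l _.
rewrite -/(ML_theta beta b l x) normrM normrMn normrX normrN normr_nat.
rewrite [leRHS]mulrnAr [leLHS]mulrnAl lerMn2r; apply/orP; right.
apply: (@le_trans _ _ (s%:R ^+ (i - l) * (C * i`!%:R * r ^+ l))).
  rewrite ler_wpM2l ?exprn_ge0// (le_trans (h l x x0))//.
  rewrite ler_wpM2r ?exprn_ge0// ler_wpM2l// ler_nat.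
  have li : (l <= i)%N by rewrite -ltnS.
  by rewrite -(bin_fact li) mulnCA leq_pmulr// muln_gt0 bin_gt0 li fact_gt0.
rewrite mulrCA ler_wpM2l ?mulr_ge0//; apply: ler_pM; rewrite ?exprn_ge0//.
  by rewrite lerXn2r ?nnegrE.
by rewrite lerXn2r ?nnegrE.
Qed.

Lemma ML_step (b x : R) : ML beta b x = rgamma b - x * ML beta (b + beta) x.
Proof.
have h : ssum (fun k => rgamma (beta * k.+1%:R + b) * k.+1%:R ^+ 0 * (- x) ^+ k.+1) =
    - x * ML beta (b + beta) x.
  rewrite -[RHS](ssumZ (- x) (@asum_ML_theta (b + beta) 0 x)).
  apply: eq_ssum => k.
  have -> : beta * k.+1%:R + b = beta * k%:R + (b + beta) by rewrite -natr1; ring.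
  by rewrite (expr0 k.+1%:R) (expr0 k%:R) exprS; ring.
rewrite [LHS](ssum_recl (@asum_ML_theta b 0 x)) h mulNr.
by rewrite mulr0 add0r expr0n expr0 !mulr1.
Qed.

(** Coefficients of the expansion of [E_beta(-x)] in powers of [1 / x]. *)
Definition ML_asymp (beta : R) (k : nat) : R :=
  (- 1) ^+ k.+1 * rgamma (1 - beta * k%:R).

(** Each step solves [ML_step] for the function with the larger second
    parameter, so the remainder is explicit. *)
Lemma ML_expansion (J : nat) (x : R) : x != 0 ->
  ML beta 1 x = \sum_(k < J) ML_asymp beta k.+1 * x ^- k.+1 +
    (- 1) ^+ J * x ^- J * ML beta (1 - beta * J%:R) x.
Proof.
move=> x0; elim: J => [|J IH].
  by rewrite big_ord0 expr0 invr1 !mul1r mulr0 subr0 add0r.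
rewrite IH big_ord_recr/= -addrA; congr (_ + _).
have := ML_step (1 - beta * J.+1%:R) x.
rewrite (_ : 1 - beta * J.+1%:R + beta = 1 - beta * J%:R); last by rewrite -natr1; ring.
move=> h.
have -> : ML beta (1 - beta * J%:R) x =
   x^-1 * (rgamma (1 - beta * J.+1%:R) - ML beta (1 - beta * J.+1%:R) x).
  by rewrite h; field.
rewrite /ML_asymp !exprS; field.
by rewrite x0 expf_neq0.
Qed.

End ML_theta.

(** * Analyticity with a uniform radius *)

Section taylor.
Context {R : realType}.
Implicit Types (F : R -> R) (r W y : R).

(** Analyticity at [y] with a radius of order [1 / r], in a form that passes to
    limits of series of functions: only the remainders are estimated, and the
    coefficients, determined by [F], are not named. *)
Definition taylor_at r W F y := exists a : nat -> R, forall N eta,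
  r * `|eta| <= 2^-1 ->
  `|F (y + eta) - \sum_(i < N) a i * eta ^+ i| <= W * (r * `|eta|) ^+ N.

Lemma taylor_at_affine r W F y (b c : R) : 0 <= r -> 0 <= W -> 0 <= b <= 1 ->
  taylor_at r W F (b * y + c) -> taylor_at r W (fun z => F (b * z + c)) y.
Proof.
move=> r0 W0 /andP[b0 b1] [a ha]; exists (fun i => a i * b ^+ i) => N eta h.
have hle : r * `|b * eta| <= r * `|eta|.
  by rewrite normrM (ger0_norm b0) ler_wpM2l// ler_piMl.
have := ha N (b * eta) (le_trans hle h).
rewrite (_ : b * y + c + b * eta = b * (y + eta) + c); last by ring.
under eq_bigr do rewrite exprMn mulrA.
move/le_trans; apply; rewrite ler_wpM2l// lerXn2r// ?nnegrE mulr_ge0//.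
Qed.

Lemma taylor_atZ r W F y c : taylor_at r W F y ->
  taylor_at r (`|c| * W) (fun z => c * F z) y.
Proof.
move=> [a ha]; exists (fun i => c * a i) => N eta h.
under eq_bigr do rewrite -mulrA.
by rewrite -mulr_sumr -mulrBr normrM -mulrA ler_wpM2l// ha.
Qed.

Lemma taylor_atD r W W' F F' y : taylor_at r W F y -> taylor_at r W' F' y ->
  taylor_at r (W + W') (fun z => F z + F' z) y.
Proof.
move=> [a ha] [a' ha']; exists (fun i => a i + a' i) => N eta h.
under eq_bigr do rewrite mulrDl.
rewrite big_split/= opprD addrACA mulrDl.
by apply: (le_trans (ler_normD _ _)); rewrite lerD ?ha ?ha'.
Qed.

Lemma taylor_at_sum (I : Type) (s : seq I) r (W : I -> R) (F : I -> R -> R) y :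
  (forall i, taylor_at r (W i) (F i) y) ->
  taylor_at r (\sum_(i <- s) W i) (fun z => \sum_(i <- s) F i z) y.
Proof.
move=> h; elim: s => [|i s IH].
  exists (fun=> 0) => N eta _; rewrite !big_nil big1 ?subr0 ?normr0 ?mul0r// => i _.
  by rewrite mul0r.
rewrite big_cons.
have -> : (fun z => \sum_(j <- i :: s) F j z) = (fun z => F i z + \sum_(j <- s) F j z).
  by apply/funext => z; rewrite big_cons.
exact: taylor_atD.
Qed.

Lemma taylor_at_le r r' W W' F y : 0 <= r <= r' -> 0 <= W <= W' ->
  taylor_at r W F y -> taylor_at r' W' F y.
Proof.
move=> /andP[r0 rr'] /andP[W0 WW'] [a ha]; exists a => N eta h.
have hle : r * `|eta| <= r' * `|eta| by rewrite ler_wpM2r.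
apply: (le_trans (ha N eta (le_trans hle h))).
apply: ler_pM => //; first by rewrite exprn_ge0// mulr_ge0.
by rewrite lerXn2r// ?nnegrE mulr_ge0// (le_trans r0).
Qed.

(** Two consecutive remainders at [r |eta| = 1/2] bound the [i]-th coefficient of
    the [n]-th function by [2 r^i W n], so the coefficients can be summed over
    [n]. *)
Lemma taylor_at_series r (W : nat -> R) (F : nat -> R -> R) y :
  0 < r -> (forall n, 0 <= W n) -> asum W ->
  (forall n, taylor_at r (W n) (F n) y) ->
  taylor_at r (ssum W) (fun z => ssum (fun n => F n z)) y.
Proof.
move=> r0 W0 hW /choice[a ha].
have ab n i : `|a n i| <= 2 * r ^+ i * W n.
  pose e := 2^-1 / r; have e0 : 0 < e by rewrite divr_gt0.
  have re : r * `|e| = 2^-1 by rewrite gtr0_norm// /e; field; rewrite gt_eqF.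
  have h1 := ha n i e; have h2 := ha n i.+1 e; rewrite re lexx in h1 h2.
  have {}h1 := h1 isT; have {}h2 := h2 isT; rewrite big_ord_recr/= in h2.
  have h3 : `|a n i * e ^+ i| <= 2 * W n * 2^-1 ^+ i.
    set S := \sum_(j < i) _ in h1 h2; set f := F n _ in h1 h2.
    have -> : a n i * e ^+ i = (f - S) - (f - (S + a n i * e ^+ i)) by ring.
    apply: (le_trans (ler_normB _ _)); apply: (le_trans (lerD h1 h2)).
    have : 0 <= W n * 2^-1 ^+ i by rewrite mulr_ge0// exprn_ge0.
    by rewrite exprS; lra.
  move: h3; rewrite normrM normrX (gtr0_norm e0) /e expr_div_n mulrA.
  rewrite ler_pdivrMr ?exprn_gt0// => h3.
  rewrite -(ler_pM2r (_ : 0 < 2^-1 ^+ i)) ?exprn_gt0 ?invr_gt0//.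
  by apply: (le_trans h3); rewrite le_eqVlt; apply/orP; left; apply/eqP; ring.
have asa i : asum (fun n => a n i).
  apply: (@asum_le _ _ (fun n => 2 * r ^+ i * W n)); last exact: asumZ.
  move=> n.
  by apply: (le_trans (ab n i)); exact: ler_norm.
exists (fun i => ssum (fun n => a n i)) => N eta h.
have asF : asum (fun n => F n (y + eta)).
  apply: asum_le hW => n; have := ha n 0%N eta h.
  by rewrite big_ord0 subr0 expr0 mulr1 (ger0_norm (W0 n)).
have -> : ssum (fun n => F n (y + eta)) - \sum_(i < N) ssum (a^~ i) * eta ^+ i =
  ssum (fun n => F n (y + eta) - \sum_(i < N) a n i * eta ^+ i).
  under [in RHS]eq_fun do under eq_bigr do rewrite mulrC.
  rewrite ssumB//; last by apply: asum_sum => i; exact: asumZ.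
  rewrite ssum_sum; last by move=> i; exact: asumZ.
  by congr (_ - _); apply: eq_bigr => i _; rewrite ssumZ// mulrC.
rewrite mulrC -ssumZ//; apply: ler_norm_ssum => [n|]; last exact: asumZ.
by rewrite mulrC; exact: ha.
Qed.

(** At the right end of the set where [F] vanishes its Taylor coefficients are
    zero, seen from the left; hence [F] vanishes a fixed distance further. *)
Lemma taylor_identity F r : 0 < r -> (forall y, exists W, taylor_at r W F y) ->
  forall y0, (forall y, y <= y0 -> F y = 0) -> forall y, F y = 0.
Proof.
move=> r0 hF y0 hy0.
pose d := (2 * r)^-1; have d0 : 0 < d by rewrite invr_gt0 mulr_gt0.
have rd : r * d = 2^-1 by rewrite /d; field; rewrite gt_eqF.
have step y1 : (forall y, y <= y1 -> F y = 0) -> forall y, y <= y1 + d -> F y = 0.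
  move=> hy1 y hy; have [/hy1//|y1y] := leP y y1.
  have [W [a ha]] := hF y1.
  have W0 : 0 <= W.
    have := ha 0%N 0; rewrite normr0 mulr0 expr0 mulr1 => h.
    by apply: le_trans (h _); rewrite // invr_ge0.
  have a0 i : a i = 0.
    elim/ltn_ind: i => i IH.
    have bnd e : 0 < e <= d -> `|a i| <= W * r ^+ i.+1 * e.
      move=> /andP[e0 ed]; have := ha i.+1 (- e).
      rewrite normrN gtr0_norm// => h.
      have re : r * e <= 2^-1 by rewrite -rd ler_wpM2l// ltW.
      have := h re.
      rewrite hy1; last by rewrite gerBl ltW.
      rewrite big_ord_recr/= big1; last by move=> j _; rewrite IH ?mul0r.
      rewrite sub0r add0r normrN normrM normrX normrN (gtr0_norm e0).
      rewrite exprMn mulrA [e ^+ i.+1]exprS mulrA.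
      by rewrite ler_pM2r// exprn_gt0.
    apply/eqP; rewrite -normr_le0; apply/ler_addgt0Pr => e e0; rewrite add0r.
    pose K := W * r ^+ i.+1 + 1.
    have K0 : 0 < K by rewrite ltr_wpDl// mulr_ge0// exprn_ge0// ltW.
    pose x := Num.min d (e / K).
    have x0 : 0 < x by rewrite lt_min d0 divr_gt0.
    apply: (le_trans (bnd x _)); first by rewrite x0 ge_min lexx.
    apply: (@le_trans _ _ (K * x)); first by rewrite ler_wpM2r ?(ltW x0)// lerDl.
    by rewrite -ler_pdivlMl// mulrC ge_min lexx orbT.
  apply/eqP; rewrite -normr_le0.
  have e0 : 0 <= y - y1 by rewrite subr_ge0 ltW.
  have ed : y - y1 <= d by rewrite lerBlDl.
  have bnd N : `|F y| <= W * 2^-1 ^+ N.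
    have := ha N (y - y1); rewrite ger0_norm// => h.
    have re : r * (y - y1) <= 2^-1 by rewrite -rd ler_wpM2l// ltW.
    have := h re; rewrite subrKC big1; last by move=> i _; rewrite a0 mul0r.
    rewrite subr0 => /le_trans; apply; rewrite ler_wpM2l// lerXn2r// nnegrE.
    by rewrite mulr_ge0// ltW.
    by rewrite invr_ge0.
  have cW : (fun N => W * 2^-1 ^+ N) @ \oo --> (0 : R).
    by apply: (@cvg_geometric R W); rewrite ger0_norm ?invr_ge0// invf_lt1// ltr1n.
  have c1 : (fun _ : nat => `|F y|) @ \oo --> `|F y| by exact: cvg_cst.
  by apply: (ler_cvg_to c1 cW); exact: nearW.
have iterd n : forall y, y <= y0 + n%:R * d -> F y = 0.
  elim: n => [|n IH]; first by rewrite mul0r addr0.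
  by move=> y; rewrite -natr1 mulrDl mul1r addrA; exact: step.
move=> y; apply: (iterd (Num.truncn ((y - y0) / d)).+1).
by rewrite -lerBlDl -ler_pdivrMr//; exact/ltW/truncnS_gt.
Qed.

End taylor.

(** * Modes in logarithmic time *)

Section exp_remainder.
Context {R : realType}.

Lemma asum_exp (z : R) : asum (fun i => z ^+ i / i`!%:R).
Proof.
rewrite /asum.
have -> : series (fun k => `|z ^+ k / k`!%:R|) = series (exp_coeff `|z|).
  by rewrite -normed_series_exp_coeff.
exact: is_cvg_series_exp_coeff.
Qed.

Lemma ssum_exp (z : R) : ssum (fun i => z ^+ i / i`!%:R) = expR z.
Proof. by []. Qed.

Lemma ssum_tail_norm (a b : nat -> R) n : asum a -> asum b -> (forall k, 0 <= b k) ->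
  (forall k, (n <= k)%N -> `|a k| <= b k) ->
  `|ssum a - \sum_(k < n) a k| <= ssum b.
Proof.
elim: n a b => [|n IH] a b ha hb b0 ab.
  by rewrite big_ord0 subr0; apply: ler_norm_ssum => // k; exact: ab.
rewrite big_ord_recl/= (ssum_recl ha) (ssum_recl hb) opprD addrACA subrr add0r.
apply: (@le_trans _ _ (ssum (fun k => b k.+1))); last by rewrite lerDr.
by apply: (IH (fun k => a k.+1) (fun k => b k.+1)) => //; try exact: asum_shift;
  move=> k nk; exact: ab.
Qed.

(** A crude bound with the factor [2^(-N)] in front: it is later multiplied by
    the coefficients of an entire function and summed, and only the decay in [N]
    matters then. *)
Lemma exp_remainder_le (z : R) N :
  `|expR z - \sum_(i < N) z ^+ i / i`!%:R| <= 2^-1 ^+ N * expR (2 * `|z|).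
Proof.
rewrite -(ssum_exp z) -(ssum_exp (2 * `|z|)) -ssumZ; last exact: asum_exp.
apply: ssum_tail_norm.
- exact: asum_exp.
- by apply: asumZ; exact: asum_exp.
- by move=> k; rewrite !mulr_ge0 ?exprn_ge0 ?invr_ge0 ?mulr_ge0.
- move=> k Nk; rewrite normrM normrX [`|_^-1|]ger0_norm ?invr_ge0//.
  rewrite mulrA ler_wpM2r ?invr_ge0// exprMn mulrA ler_peMl ?exprn_ge0//.
  rewrite exprVn mulrC ler_pdivlMr ?exprn_gt0// mul1r.
  by rewrite ler_eXn2l// ltr1n.
Qed.

End exp_remainder.

Section ML_taylor.
Context {R : realType}.
Variable beta : R.
Hypothesis beta01 : 0 < beta < 1.

Let beta0 : 0 < beta. Proof. by case/andP: beta01. Qed.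

(** In the variable [z = ln x] the function [x^(-s) E_(beta,b)(-x)] is a series
    of exponentials [e^((k - s) z)]; expanding each of them gives a convergent
    Taylor series, whose coefficients are bounded uniformly in the base point by
    [ML_theta_shift_bound].  The weight [e^(- s y)] is what makes the series over
    the modes converge. *)
Lemma ML_taylor (b : R) (s : nat) : exists C r : R, [/\ 0 <= C, 0 < r & forall y,
  taylor_at r (C * expR (- (s%:R * y)))
    (fun z => expR (- (s%:R * z)) * ML beta b (expR z)) y].
Proof.
have [C [r [C0 r1 bnd]]] := ML_theta_shift_bound beta01 b s.
exists (2 * C), r; split; [by rewrite mulr_ge0|by lra|move=> y].
have r0 : 0 <= r by lra.
pose x := expR y; have x0 : 0 < x by exact: expR_gt0.
pose e := expR (- (s%:R * y)); have e0 : 0 <= e by exact: expR_ge0.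
pose th i := ssum (fun k => rgamma (beta * k%:R + b) * (k%:R - s%:R) ^+ i * (- x) ^+ k).
pose a i := e * th i / i`!%:R.
have abnd i : `|a i| <= e * C * r ^+ i.
  have f0 : (0 : R) < i`!%:R by rewrite ltr0n fact_gt0.
  rewrite /a normrM [`|_^-1|]ger0_norm ?invr_ge0// normrM (ger0_norm e0).
  rewrite ler_pdivrMr// -!mulrA ler_wpM2l//.
  by apply: (le_trans (bnd i x x0)); rewrite le_eqVlt; apply/orP; left; apply/eqP; ring.
have sgp i : subgeometric (fun k => (k%:R - s%:R) ^+ i : R).
  apply: subgeometricX; apply: subgeometricD; first exact: subgeometric_nat.
  exact: subgeometric_cst.
exists a => N eta heta.
pose q k := rgamma (beta * k%:R + b) * (- x) ^+ k.
have FE : expR (- (s%:R * (y + eta))) * ML beta b (expR (y + eta)) =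
    e * ssum (fun k => q k * expR ((k%:R - s%:R) * eta)).
  have -> : expR (- (s%:R * (y + eta))) = e * expR (- (s%:R * eta)).
    by rewrite /e -expRD; congr expR; ring.
  rewrite -mulrA; congr (_ * _).
  rewrite -[LHS](ssumZ _ (@asum_ML_theta _ _ beta01 b 0 (expR (y + eta)))).
  apply: eq_ssum => k; rewrite /q.
  have -> : (- expR (y + eta)) ^+ k = (- x) ^+ k * expR (k%:R * eta).
    by rewrite expRD -mulNr exprMn expRM_natl.
  have -> : expR ((k%:R - s%:R) * eta) = expR (- (s%:R * eta)) * expR (k%:R * eta).
    by rewrite -expRD; congr expR; ring.
  by rewrite (expr0 k%:R); ring.
have as1 : asum (fun k => q k * expR ((k%:R - s%:R) * eta)).
  have -> : (fun k => q k * expR ((k%:R - s%:R) * eta)) =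
     (fun k => expR (- (s%:R * eta)) *
       (rgamma (beta * k%:R + b) * 1 * (- x * expR eta) ^+ k)).
    apply/funext => k; rewrite exprMn -(expRM_natl k eta) /q.
    have -> : expR ((k%:R - s%:R) * eta) = expR (- (s%:R * eta)) * expR (k%:R * eta).
      by rewrite -expRD; congr expR; ring.
    by ring.
  apply: asumZ; apply: asum_ML => //; exact: subgeometric_cst.
(* absolute convergence: the remainder after N' terms is at most a constant,
   depending on y and eta, times 2 ^ (- N') *)
pose Mk k := `|q k| * expR (2 * `|(k%:R - s%:R) * eta|).
have asM : asum Mk.
  apply: (@asum_le _ _ (fun k => expR (2 * (s%:R * `|eta|)) *
     `|rgamma (beta * k%:R + b) * 1 * (x * expR (2 * `|eta|)) ^+ k|)); last first.
    apply: asumZ; apply: asum_norm; apply: asum_ML => //; exact: subgeometric_cst.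
  move=> k; rewrite ger0_norm ?mulr_ge0 ?expR_ge0//.
  rewrite [leRHS]ger0_norm ?mulr_ge0 ?expR_ge0//.
  rewrite /Mk /q; set g := rgamma _.
  have -> : `|g * 1 * (x * expR (2 * `|eta|)) ^+ k| =
      `|g * (- x) ^+ k| * expR (k%:R * (2 * `|eta|)).
    rewrite mulr1 exprMn -(expRM_natl k (2 * `|eta|)); set E := expR _.
    by rewrite !normrM !normrX normrN (ger0_norm (expR_ge0 _ : 0 <= E)) mulrA.
  rewrite mulrCA ler_wpM2l// -expRD ler_expR normrM.
  have : `|k%:R - s%:R| <= k%:R + s%:R :> R.
    by apply: (le_trans (ler_normB _ _)); rewrite !normr_nat.
  move/(ler_wpM2r (normr_ge0 eta)) => h.
  by rewrite mulrCA; lra.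
pose T N' := \sum_(i < N') a i * eta ^+ i.
have trunc N' : `|e * ssum (fun k => q k * expR ((k%:R - s%:R) * eta)) - T N'| <=
    e * ssum Mk * 2^-1 ^+ N'.
  have asP i : asum (fun k => q k * (((k%:R - s%:R) * eta) ^+ i / i`!%:R)).
    have -> : (fun k => q k * (((k%:R - s%:R) * eta) ^+ i / i`!%:R)) =
      (fun k => (eta ^+ i / i`!%:R) * (rgamma (beta * k%:R + b) *
          (k%:R - s%:R) ^+ i * (- x) ^+ k)).
      by apply/funext => k; rewrite /q exprMn; ring.
    by apply: asumZ; apply: asum_ML => //; exact: sgp.
  have TE : T N' = e * ssum (fun k => \sum_(i < N') q k * (((k%:R - s%:R) * eta) ^+ i / i`!%:R)).
    rewrite ssum_sum// mulr_sumr; apply: eq_bigr => i _.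
    have -> : (fun k => q k * (((k%:R - s%:R) * eta) ^+ i / i`!%:R)) =
      (fun k => (eta ^+ i / i`!%:R) * (rgamma (beta * k%:R + b) *
          (k%:R - s%:R) ^+ i * (- x) ^+ k)).
      by apply/funext => k; rewrite /q exprMn; ring.
    rewrite ssumZ; last by apply: asum_ML => //; exact: sgp.
    by rewrite -/(th i) /a; ring.
  rewrite TE -mulrBr normrM (ger0_norm e0) -mulrA ler_wpM2l//.
  rewrite -ssumB//; last exact: asum_sum.
  rewrite mulrC -ssumZ//; apply: ler_norm_ssum => [k|]; last exact: asumZ.
  rewrite -mulr_sumr -mulrBr normrM /Mk mulrCA ler_wpM2l//.
  exact: exp_remainder_le.
rewrite FE.
have tailT N' : (N <= N')%N -> `|T N' - T N| <= 2 * C * e * (r * `|eta|) ^+ N.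
  move=> /subnKC <-; set M := (N' - N)%N.
  have -> : T (N + M)%N - T N = \sum_(i < M) a (N + i)%N * eta ^+ (N + i).
    by rewrite /T big_split_ord/= [X in X - _ = _]addrC addrK.
  apply: (le_trans (ler_norm_sum _ _ _)).
  have h0 : 0 <= r * `|eta| by rewrite mulr_ge0.
  apply: (@le_trans _ _ (\sum_(i < M) e * C * (r * `|eta|) ^+ N * 2^-1 ^+ i)).
    apply: ler_sum => i _; rewrite normrM normrX.
    apply: (@le_trans _ _ (e * C * r ^+ (N + i) * `|eta| ^+ (N + i))).
      by rewrite ler_wpM2r ?exprn_ge0.
    rewrite -!mulrA -exprMn exprD.
    by rewrite !(ler_wpM2l, mulr_ge0, exprn_ge0)// lerXn2r ?nnegrE ?invr_ge0.
  rewrite -mulr_sumr (_ : 2 * C * e * _ = e * C * (r * `|eta|) ^+ N * 2); last by ring.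
  rewrite ler_wpM2l ?mulr_ge0 ?exprn_ge0//.
  suff : \sum_(i < M) 2^-1 ^+ i <= 2 - 2^-1 ^+ M * 2 :> R.
    move/le_trans; apply; rewrite gerBl mulr_ge0// exprn_ge0// invr_ge0//.
  elim: (M) => [|i IH]; first by rewrite big_ord0 expr0; lra.
  by rewrite big_ord_recr/= exprS; lra.
have cl : (fun N' => e * ssum Mk * 2^-1 ^+ N' + 2 * C * e * (r * `|eta|) ^+ N) @ \oo -->
    (0 + 2 * C * e * (r * `|eta|) ^+ N : R).
  apply: cvgD; last exact: cvg_cst.
  apply: (@cvg_geometric R (e * ssum Mk)).
  by rewrite ger0_norm ?invr_ge0// invf_lt1// ltr1n.
have cc : (fun _ : nat => `|e * ssum (fun k => q k * expR ((k%:R - s%:R) * eta)) - T N|)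
   @ \oo --> `|e * ssum (fun k => q k * expR ((k%:R - s%:R) * eta)) - T N|.
  exact: cvg_cst.
rewrite add0r in cl.
apply: (ler_cvg_to cc cl); near=> N'.
have NN' : (N <= N')%N by near: N'; exact: nbhs_infty_ge.
set S := e * ssum _.
have -> : S - T N = (S - T N') + (T N' - T N) by ring.
by apply: (le_trans (ler_normD _ _)); apply: lerD; [exact: trunc|exact: tailT].
Unshelve. all: by end_near. Qed.

End ML_taylor.

(** * Filtering the slowly decaying terms *)

Section filtered_series.
Context {R : realType}.
Variables (beta : R) (c m : nat -> R) (K : nat) (P : {poly R}).
Hypothesis beta01 : 0 < beta < 1.
Hypothesis m_gt0 : forall n, 0 < m n.
Hypothesis cm_sum : forall k, (K <= k)%N -> asum (fun n => c n * m n ^- k).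
Hypothesis P_root : forall k, (0 < k <= K)%N -> P.[expR (beta * k%:R)] = 0.

Let beta0 : 0 < beta. Proof. by case/andP: beta01. Qed.

(** The filter [w |-> sum_i P_i w(y - i)] multiplies [e^(- kappa y)] by
    [P(e^kappa)], so the roots of [P] are the exponents it annihilates. *)
Definition filtered_mode (beta : R) (m : nat -> R) (P : {poly R}) (n : nat) (y : R) : R :=
  \sum_(i < size P) P`_i * ML beta 1 (m n * expR (beta * (y - i%:R))).

Definition filtered_sum (beta : R) (c m : nat -> R) (P : {poly R}) (y : R) : R :=
  ssum (fun n => c n * filtered_mode beta m P n y).

Definition power_moment (c m : nat -> R) (k : nat) : R := ssum (fun n => c n * m n ^- k).

Definition asymp_coef (beta : R) (c m : nat -> R) (P : {poly R}) (k : nat) : R :=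
  ML_asymp beta k * P.[expR (beta * k%:R)] * power_moment c m k.

Let remainder J n y := \sum_(i < size P) P`_i * ((- 1) ^+ J *
  (m n * expR (beta * (y - i%:R))) ^- J *
  ML beta (1 - beta * J%:R) (m n * expR (beta * (y - i%:R)))).

Let argE (k : nat) n i y : (m n * expR (beta * (y - i%:R))) ^- k =
  m n ^- k * expR (- (beta * k%:R * y)) * expR (beta * k%:R) ^+ i.
Proof.
rewrite exprMn invfM -mulrA; congr (_ * _).
rewrite -!expRM_natl -expRN -expRD; congr expR; ring.
Qed.

Let filtered_modeE J n y : (K <= J)%N ->
  filtered_mode beta m P n y =
  \sum_(K.+1 <= k < J.+1) ML_asymp beta k * P.[expR (beta * k%:R)] * m n ^- k *
     expR (- (beta * k%:R * y)) + remainder J n y.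
Proof.
move=> KJ.
have x0 i : m n * expR (beta * (y - i%:R)) != 0 :> R.
  by rewrite mulf_neq0 ?gt_eqF// expR_gt0.
rewrite /filtered_mode; under eq_bigr => i _ do rewrite (@ML_expansion _ _ beta01 J)// mulrDr.
rewrite big_split/=; congr (_ + _).
have -> : \sum_(K.+1 <= k < J.+1) ML_asymp beta k * P.[expR (beta * k%:R)] *
       m n ^- k * expR (- (beta * k%:R * y)) =
   \sum_(1 <= k < J.+1) ML_asymp beta k * P.[expR (beta * k%:R)] *
       m n ^- k * expR (- (beta * k%:R * y)).
  rewrite [RHS](@big_cat_nat _ _ _ K.+1)//= [X in _ = X + _]big_nat_cond.
  rewrite [X in _ = X + _]big1 ?add0r// => k /andP[/andP[k0 kK] _].
  by rewrite P_root ?k0//= mulr0 !mul0r.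
rewrite big_add1/= big_mkord.
under eq_bigr do rewrite mulr_sumr.
rewrite exchange_big/=; apply: eq_bigr => k _.
rewrite horner_coef mulr_sumr !mulr_suml; apply: eq_bigr => i _.
by rewrite argE; ring.
Qed.

Let remainder_le J : exists2 C : R, 0 <= C & forall n y,
  `|remainder J n y| <= C * m n ^- J * expR (- (beta * J%:R * y)).
Proof.
have [C [r [C0 r1 bnd]]] := ML_theta_bound beta01 (1 - beta * J%:R).
exists (\sum_(i < size P) `|P`_i| * (C * expR (beta * J%:R) ^+ i)).
  by apply: sumr_ge0 => i _; rewrite !mulr_ge0// exprn_ge0// expR_ge0.
move=> n y; apply: (le_trans (ler_norm_sum _ _ _)).
rewrite !mulr_suml; apply: ler_sum => i _.
have x0 : 0 < m n * expR (beta * (y - i%:R)) by rewrite mulr_gt0// expR_gt0.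
have := bnd 0%N _ x0; rewrite expr0 fact0 !mulr1 => h.
have d0 : 0 <= m n ^- J * expR (- (beta * J%:R * y)) * expR (beta * J%:R) ^+ i.
  by rewrite !mulr_ge0 ?exprn_ge0 ?expR_ge0// invr_ge0 exprn_ge0// ltW.
apply: (@le_trans _ _ (`|P`_i| * (m n ^- J * expR (- (beta * J%:R * y)) *
    expR (beta * J%:R) ^+ i * C))); last first.
  by rewrite le_eqVlt; apply/orP; left; apply/eqP; ring.
rewrite argE normrM ler_wpM2l// normrM normrM normrX normrN1 expr1n mul1r.
by rewrite (ger0_norm d0) ler_wpM2l.
Qed.

Let asum_remainder J y : (K <= J)%N -> asum (fun n => c n * remainder J n y).
Proof.
move=> KJ; have [C C0 h] := remainder_le J.
apply: (@asum_le _ _ (fun n => (C * expR (- (beta * J%:R * y))) * (c n * m n ^- J))); last first.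
  by apply: asumZ; exact: cm_sum.
move=> n; rewrite normrM.
rewrite [leRHS](_ : _ = `|c n| * (C * m n ^- J * expR (- (beta * J%:R * y)))).
  by rewrite ler_wpM2l// h.
have mJ : 0 <= m n ^- J by rewrite invr_ge0 exprn_ge0// ltW.
rewrite !normrM (ger0_norm C0) (ger0_norm (expR_ge0 _)) (ger0_norm mJ); ring.
Qed.

(** Absolute convergence allows the expansions of the modes to be summed over
    [n], which turns the coefficients into moments. *)
Lemma filtered_sum_asymp J : (K <= J)%N -> exists C : R, forall y,
  `|filtered_sum beta c m P y - \sum_(K.+1 <= k < J.+1)
      asymp_coef beta c m P k * expR (- (beta * k%:R * y))| <=
  C * expR (- (beta * J%:R * y)).
Proof.
move=> KJ; have [C C0 h] := remainder_le J.
exists (C * ssum (fun n => `|c n * m n ^- J|)) => y.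
have asT k : asum (fun n => if (K < k)%N then ML_asymp beta k * P.[expR (beta * k%:R)] *
    expR (- (beta * k%:R * y)) * (c n * m n ^- k) else 0 * (c n * m n ^- K)).
  by case: ltnP => Kk; apply: asumZ; apply: cm_sum => //; exact: ltnW.
have fE : filtered_sum beta c m P y = \sum_(K.+1 <= k < J.+1)
      asymp_coef beta c m P k * expR (- (beta * k%:R * y)) +
      ssum (fun n => c n * remainder J n y).
  rewrite /filtered_sum.
  have -> : (fun n => c n * filtered_mode beta m P n y) = (fun n =>
     (\sum_(K.+1 <= k < J.+1) (if (K < k)%N then ML_asymp beta k * P.[expR (beta * k%:R)] *
       expR (- (beta * k%:R * y)) * (c n * m n ^- k) else 0 * (c n * m n ^- K)))
     + c n * remainder J n y).
    apply/funext => n; rewrite (filtered_modeE _ _ KJ) mulrDr; congr (_ + _).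
    rewrite mulr_sumr; apply: eq_big_nat => k /andP[-> _]; ring.
  rewrite ssumD; [|exact: asum_sum|exact: asum_remainder].
  congr (_ + _); rewrite ssum_sum//; apply: eq_big_nat => k /andP[Kk _].
  by rewrite Kk ssumZ; [rewrite /asymp_coef/power_moment; ring|apply: cm_sum; exact: ltnW].
rewrite fE [X in X - _]addrC addrK.
have -> : C * ssum (fun n => `|c n * m n ^- J|) * expR (- (beta * J%:R * y)) =
  ssum (fun n => C * expR (- (beta * J%:R * y)) * `|c n * m n ^- J|).
  by rewrite ssumZ; [ring|apply: asum_norm; exact: cm_sum].
apply: ler_norm_ssum => [n|]; last by apply: asumZ; apply: asum_norm; exact: cm_sum.
rewrite !normrM.
have mJ : 0 <= m n ^- J by rewrite invr_ge0 exprn_ge0// ltW.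
apply: (le_trans (ler_wpM2l (normr_ge0 (c n)) (h n y))); rewrite (ger0_norm mJ).
by rewrite le_eqVlt; apply/orP; left; apply/eqP; ring.
Qed.

(** The radius does not depend on the mode because the modes are translates of
    one function of [beta y]. *)
Lemma filtered_sum_taylor : exists2 r : R, 0 < r & forall y, exists2 W, 0 <= W &
  taylor_at r W (filtered_sum beta c m P) y.
Proof.
have [C [r [C0 r0 tay]]] := ML_taylor beta01 (1 - beta * K%:R) K.
exists r => // y.
pose F z : R := expR (- (K%:R * z)) * ML beta (1 - beta * K%:R) (expR z).
have argE2 n i z : m n * expR (beta * (z - i%:R)) =
    expR (beta * z + (ln (m n) - beta * i%:R)).
  rewrite -{1}(lnK (m_gt0 n : m n \is Num.pos)) -expRD; congr expR; ring.
have FE n : (fun z => c n * filtered_mode beta m P n z) = (fun z => c n *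
    \sum_(i < size P) (P`_i * (- 1) ^+ K) * F (beta * z + (ln (m n) - beta * i%:R))).
  apply/funext => z; rewrite (filtered_modeE _ _ (leqnn K)) big_geq// add0r.
  congr (_ * _); apply: eq_bigr => i _; rewrite argE2 /F -expRM_natl -expRN; ring.
pose V n := `|c n| * \sum_(i < size P) (`|P`_i * (- 1) ^+ K| *
   (C * expR (- (K%:R * (beta * y + (ln (m n) - beta * i%:R)))))).
pose B := \sum_(i < size P) (`|P`_i * (- 1) ^+ K| *
   (C * expR (- (K%:R * (beta * y - beta * i%:R))))).
have V0 n : 0 <= V n.
  rewrite mulr_ge0//; apply: sumr_ge0 => i _.
  by rewrite !mulr_ge0// expR_ge0.
have VE n : V n = B * `|c n * m n ^- K|.
  have mK : m n ^- K = expR (- (K%:R * ln (m n))).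
    by rewrite expRN expRM_natl lnK// posrE.
  rewrite /V /B normrM mK (ger0_norm (expR_ge0 _)) mulrCA; congr (_ * _).
  rewrite mulr_suml; apply: eq_bigr => i _.
  by rewrite -!mulrA -expRD; congr (_ * (_ * expR _)); ring.
have asV : asum V.
  rewrite (_ : V = fun n => B * `|c n * m n ^- K|); last exact/funext.
  by apply: asumZ; apply: asum_norm; exact: cm_sum.
exists (ssum V); first by have := series_le_ssum 0 V0 asV; rewrite big_ord0.
apply: taylor_at_series => // n; rewrite FE; apply: taylor_atZ.
apply: taylor_at_sum => i; apply: taylor_atZ.
apply: taylor_at_affine; [exact: ltW|by rewrite mulr_ge0// expR_ge0| |exact: tay].
by case/andP: beta01 => h0 h1; rewrite !ltW.
Qed.

End filtered_series.

(** * Uniqueness of exponential expansions *)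

Section exponential_sums.
Context {R : realType}.

Lemma expR_decay_cvg (a b : R) : 0 < a ->
  (fun n : nat => b * expR (- (a * n%:R))) @ \oo --> (0 : R).
Proof.
move=> a0; have -> : (fun n : nat => b * expR (- (a * n%:R))) = geometric b (expR (- a)).
  by apply/funext => n /=; rewrite -expRM_natr mulNr.
by apply: cvg_geometric; rewrite ger0_norm ?expR_ge0// expR_lt1 oppr_lt0.
Qed.

Lemma seq_min (s : seq R) : s != [::] -> exists2 x, x \in s & forall z, z \in s -> x <= z.
Proof.
elim: s => // x s IH _; have [->|/IH[z zs hz]] := eqVneq s [::].
  by exists x; rewrite ?mem_head// => z; rewrite inE => /eqP ->.
have [xz|zx] := leP x z.
  exists x; first exact: mem_head.
  by move=> t; rewrite inE => /predU1P[->//|/hz]; exact: le_trans.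
exists z; first by rewrite inE zs orbT.
by move=> t; rewrite inE => /predU1P[->|/hz//]; exact: ltW.
Qed.

(** The least exponent carrying a nonzero coefficient dominates the sum, so it
    cannot be smaller than the rate of decay. *)
Lemma exponential_sum_uniq (q : R -> R) (M C : R) (es : seq R) : uniq es ->
  (forall y, 0 <= y -> `|\sum_(e <- es) q e * expR (- (e * y))| <= C * expR (- (M * y))) ->
  forall e, e \in es -> e < M -> q e = 0.
Proof.
move=> ues hq; pose bad := [seq e <- es | (e < M) && (q e != 0)].
suff bad0 : bad = [::].
  move=> e ees eM; apply/eqP/negPn/negP => qe.
  by have : e \in bad; [rewrite mem_filter eM qe|rewrite bad0].
apply/eqP/negPn/negP => /seq_min[e0]; rewrite mem_filter => /andP[/andP[e0M q0] e0es] hmin.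
pose g (n : nat) := C * expR (- ((M - e0) * n%:R)) +
  \sum_(e <- es | e != e0) (`|q e| * expR (- ((e - e0) * n%:R))).
have gcvg : g @ \oo --> (0 + \sum_(e <- es | e != e0) 0 : R).
  apply: cvgD; first by apply: expR_decay_cvg; rewrite subr_gt0.
  rewrite [X in _ --> X]big_seq_cond.
  under eq_fun do rewrite big_seq_cond.
  apply: (@cvg_big _ _ +%R 0 _ add_continuous) => e /andP[ees ee0].
  have [qe0|qe0] := eqVneq (q e) 0.
    by rewrite qe0 normr0; under eq_fun do rewrite mul0r; exact: cvg_cst.
  apply: expR_decay_cvg; rewrite subr_gt0.
  have [eM|Me] := ltP e M; last exact: lt_le_trans Me.
  by rewrite lt_neqAle eq_sym ee0/=; apply: hmin; rewrite mem_filter eM qe0.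
have qg (n : nat) : `|q e0| <= g n.
  have := hq n%:R (ler0n _ _); rewrite (bigD1_seq e0)//=.
  set S := \sum_(e <- es | e != e0) _ => h.
  have E0 : 0 < expR (e0 * n%:R) := expR_gt0 _.
  have h1 : `|q e0| * expR (- (e0 * n%:R)) <= C * expR (- (M * n%:R)) + `|S|.
    rewrite -[X in _ * X <= _]ger0_norm ?expR_ge0// -normrM.
    set t := q e0 * _ in h *; have -> : t = (t + S) - S by ring.
    by apply: (le_trans (ler_normB _ _)); rewrite lerD2r.
  have := ler_wpM2r (ltW E0) h1.
  rewrite -mulrA -expRD addNr expR0 mulr1 mulrDl -mulrA -expRD => /le_trans; apply.
  rewrite /g; apply: lerD.
    by rewrite (_ : - ((M - e0) * n%:R) = - (M * n%:R) + e0 * n%:R)//; ring.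
  apply: (le_trans (ler_wpM2r (ltW E0) (ler_norm_sum _ _ _))).
  rewrite mulr_suml le_eqVlt; apply/orP; left; apply/eqP; apply: eq_bigr => e _.
  rewrite normrM [`|expR _|]ger0_norm ?expR_ge0// -mulrA -expRD.
  by congr (_ * expR _); ring.
have c1 : (fun _ : nat => `|q e0|) @ \oo --> `|q e0| by exact: cvg_cst.
have : `|q e0| <= 0 + \sum_(e <- es | e != e0) 0.
  by apply: (ler_cvg_to c1 gcvg); exact: nearW.
by rewrite big1// addr0 normr_le0 (negbTE q0).
Qed.

Lemma big_eq1_seq (es : seq R) (F : R -> R) x : uniq es -> x \in es ->
  \sum_(e <- es | x == e) F e = F x.
Proof.
by move=> ues xes; rewrite big_mkcond (bigD1_seq x)//= eqxx big1 ?addr0// => e;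
  rewrite eq_sym => /negbTE ->.
Qed.

(** Collecting equal exponents reduces the statement to [exponential_sum_uniq]
    for a total coefficient [q]; the exponents up to [b k] are all below the
    rate of decay once [J] is large. *)
Lemma exponent_match (b b' : R) (a a' : nat -> R) (K : nat) : 0 < b -> 0 < b' ->
  (forall J, (K <= J)%N -> exists C : R, forall y, 0 <= y ->
     `|\sum_(K.+1 <= k < J.+1) a k * expR (- (b * k%:R * y)) -
       \sum_(K.+1 <= k < J.+1) a' k * expR (- (b' * k%:R * y))| <=
     C * expR (- (Num.min b b' * J%:R * y))) ->
  forall k, (K < k)%N ->
    (a k != 0 -> exists k', b' * k'%:R = b * k%:R) /\ (b = b' -> a k = a' k).
Proof.
move=> b0 b'0 H k Kk; pose mb := Num.min b b'.
have mb0 : 0 < mb by rewrite lt_min b0.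
pose J := maxn k (Num.truncn (b * k%:R / mb)).+1.
have kJ : (k <= J)%N by exact: leq_maxl.
have [C hC] := H J (leq_trans (ltnW Kk) kJ).
have bkM : b * k%:R < mb * J%:R.
  rewrite [ltRHS]mulrC -ltr_pdivrMr//; apply: lt_le_trans (truncnS_gt _) _.
  by rewrite ler_nat leq_maxr.
pose s := index_iota K.+1 J.+1.
pose q e := \sum_(j <- s | b * j%:R == e) a j - \sum_(j <- s | b' * j%:R == e) a' j.
pose es := undup ([seq b * j%:R | j <- s] ++ [seq b' * j%:R | j <- s]).
have ues : uniq es by exact: undup_uniq.
have ks : k \in s by rewrite mem_index_iota Kk ltnS.
have regroup (d : R) (x : nat -> R) y : {subset [seq d * j%:R | j <- s] <= es} ->
    \sum_(e <- es) (\sum_(j <- s | d * j%:R == e) x j) * expR (- (e * y)) =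
    \sum_(j <- s) x j * expR (- (d * j%:R * y)).
  move=> sub; under eq_bigr do rewrite mulr_suml.
  rewrite (exchange_big_dep xpredT)//= big_seq [RHS]big_seq.
  apply: eq_bigr => j js; rewrite (big_eq1_seq _ ues)//.
  by apply: sub; exact: (map_f (fun j => d * j%:R) js).
have q0 : q (b * k%:R) = 0.
  apply: (@exponential_sum_uniq q (mb * J%:R) C es ues) => //; last first.
    rewrite mem_undup mem_cat; apply/orP; left.
    exact: (map_f (fun j => b * j%:R) ks).
  move=> y y0; rewrite /q; under eq_bigr do rewrite mulrBl.
  rewrite sumrB !regroup; [exact: hC| |];
    by move=> e he; rewrite mem_undup mem_cat he ?orbT.
have qa : \sum_(j <- s | b * j%:R == b * k%:R) a j = a k.
  rewrite -[RHS]addr0 big_mkcond (bigD1_seq k)//= ?iota_uniq// eqxx; congr (_ + _).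
  rewrite big1// => j jk; case: eqP => // /(mulfI (lt0r_neq0 b0))/eqP.
  by rewrite eqr_nat (negbTE jk).
move: q0; rewrite /q qa => /eqP; rewrite subr_eq0 => /eqP ->; split.
  have [/hasP[j js /eqP e] _|/hasPn h] := boolP (has (fun j => b' * j%:R == b * k%:R) s).
    by exists j.
  by rewrite big_seq_cond big1 ?eqxx// => j /andP[js]; rewrite (negbTE (h j js)).
move=> bb'; rewrite -bb'.
rewrite -[RHS]addr0 big_mkcond (bigD1_seq k)//= ?iota_uniq// eqxx; congr (_ + _).
rewrite big1// => j jk; case: eqP => // /(mulfI (lt0r_neq0 b0))/eqP.
by rewrite eqr_nat (negbTE jk).
Qed.

End exponential_sums.

(** * Arithmetic of the visible exponents *)

Section exponent_gap.
Context {R : realType}.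
Implicit Types (b : R).

Definition is_nat_mult b (k : nat) := exists i : nat, b * k%:R = i%:R.

Lemma nat_mult_gap b k : 0 < b < 1 -> is_nat_mult b k -> ~ is_nat_mult b k.+1.
Proof.
move=> /andP[b0 b1] [i hi] [j]; rewrite -natr1 mulrDr hi mulr1 => h.
have ij : (i < j)%N by rewrite -(ltr_nat R) -h ltrDl.
have : (j < i.+1)%N by rewrite -(ltr_nat R) -h -natr1 ltrD2l.
by rewrite ltnS leqNgt ij.
Qed.

Lemma nat_mult_half b k0 : 0 < b < 1 ->
  (forall k, (k0 <= k)%N -> is_nat_mult b k \/ is_nat_mult b k.+1) -> 2 * b = 1.
Proof.
move=> b01 h.
have [k k0k Sk] : exists2 k, (k0 <= k)%N & is_nat_mult b k.
  by have [S|S] := h k0 (leqnn _); [exists k0|exists k0.+1].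
have nS := nat_mult_gap b01 Sk.
have [//|[j hj]] := h k.+1 (leq_trans k0k (leqnSn _)).
have /andP[b0 b1] := b01; have [i hi] := Sk.
move: hj; rewrite -addn2 natrD mulrDr hi => hj.
have ij : (i < j)%N by rewrite -(ltr_nat R) -hj; lra.
have ji : (j < i.+2)%N by rewrite -(ltr_nat R) -hj -[i.+2]addn2 natrD; lra.
have ej : j = i.+1 by apply/eqP; rewrite eqn_leq ij andbT -ltnS.
by move: hj; rewrite ej -natr1; lra.
Qed.

Lemma common_mult_step b b' k k1 k2 : 0 < b -> 0 < b' ->
  b' * k1%:R = b * k%:R -> b' * k2%:R = b * k.+1%:R ->
  exists2 j : nat, (0 < j)%N & b = b' * j%:R.
Proof.
move=> b0 b'0 e1 e2.
have k12 : (k1 < k2)%N.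
  by rewrite -(ltr_nat R) -(ltr_pM2l b'0) e1 e2 ltr_pM2l// ltr_nat.
exists (k2 - k1)%N; first by rewrite subn_gt0.
by rewrite natrB ?(ltnW k12)// mulrBr e1 e2 -natr1; ring.
Qed.

Let not_lt b b' k0 : 0 < b < 1 -> 0 < b' < 1 ->
  (forall k, (k0 <= k)%N -> ~ is_nat_mult b k -> exists k' : nat, b' * k'%:R = b * k%:R) ->
  (forall k, (k0 <= k)%N -> ~ is_nat_mult b' k -> exists k' : nat, b * k'%:R = b' * k%:R) ->
  ~ b < b'.
Proof.
move=> b01 b'01 h h' bb'.
have /andP[b0 b1] := b01; have /andP[b'0 b'1] := b'01.
have b2 : 2 * b = 1.
  apply: (@nat_mult_half _ k0) => // k k0k.
  have [S|S] := pselect (is_nat_mult b k); first by left.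
  have [S1|S1] := pselect (is_nat_mult b k.+1); first by right.
  have [k1 e1] := h _ k0k S; have [k2 e2] := h _ (leq_trans k0k (leqnSn _)) S1.
  have [j j0 bj] := common_mult_step b0 b'0 e1 e2.
  by move: bb'; rewrite bj ltNge ler_peMr ?(ltW b'0)// ler1n.
have b'2 : 2 * b' = 1.
  apply: (@nat_mult_half _ k0) => // k k0k.
  have [S|S] := pselect (is_nat_mult b' k); first by left.
  have [S1|S1] := pselect (is_nat_mult b' k.+1); first by right.
  have [k1 e1] := h' _ k0k S; have [k2 e2] := h' _ (leq_trans k0k (leqnSn _)) S1.
  have [j j0 bj] := common_mult_step b'0 b0 e1 e2.
  have j1 : (1 < j)%N.
    by rewrite -(ltr_nat R) -(ltr_pM2l b0) mulr1 -bj.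
  have : (2 : R) <= j%:R by rewrite ler_nat.
  by rewrite -(ler_pM2l b0) -bj mulrC b2; lra.
by move: bb'; lra.
Qed.

(** Suppose [b < b'].  Two consecutive non-integral multiples of [b] would be
    multiples of [b'] at the distance [b], which is too close; hence [b = 1/2],
    the only step in (0, 1) for which consecutive multiples are never both
    non-integral.  Then [b' = 1/2] as well, since [b'] would otherwise be a
    multiple of [b] larger than [b], hence at least 1. *)
Lemma progression_step_eq b b' k0 : 0 < b < 1 -> 0 < b' < 1 ->
  (forall k, (k0 <= k)%N -> ~ is_nat_mult b k -> exists k' : nat, b' * k'%:R = b * k%:R) ->
  (forall k, (k0 <= k)%N -> ~ is_nat_mult b' k -> exists k' : nat, b * k'%:R = b' * k%:R) ->
  b = b'.
Proof.
move=> b01 b'01 h h'; apply/eqP; rewrite eq_le !leNgt.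
by apply/andP; split; apply/negP; apply: not_lt; eassumption.
Qed.

End exponent_gap.

(** * Moments determine the nodes *)

Section moments.
Context {R : realType}.
Implicit Types (c m : nat -> R).

Lemma geometric_small (T q e : R) : 0 <= q < 1 -> 0 < e ->
  exists N, forall k, (N <= k)%N -> T * q ^+ k < e.
Proof.
move=> /andP[q0 q1] e0.
have h : (fun k => T * q ^+ k) @ \oo --> (0 : R).
  by have := @cvg_geometric R T q; rewrite ger0_norm// => /(_ q1).
have := cvgr_lt _ h _ e0 => -[N _ hN].
by exists N => k Nk; exact: hN.
Qed.

Lemma power_moment_tail c m K N k : (forall n, 0 < m n) -> {homo m : i j / (i < j)%N >-> i < j} ->
  (forall k, (K <= k)%N -> asum (fun n => c n * m n ^- k)) -> (K <= k)%N ->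
  `|power_moment c m k - \sum_(n < N) c n * m n ^- k| <=
  ssum (fun n => `|c n * m n ^- K|) * m N ^- (k - K).
Proof.
move=> m0 minc hK Kk.
have mN0 : 0 <= m N ^- (k - K) by rewrite invr_ge0 exprn_ge0// ltW.
have aK := asum_norm (hK K (leqnn K)).
rewrite mulrC -ssumZ//; apply: ssum_tail_norm.
- exact: hK.
- exact: asumZ.
- by move=> n; rewrite mulr_ge0.
- move=> n Nn; rewrite -{1}(subnK Kk) exprD invfM mulrA mulrAC normrM mulrC.
  apply: ler_wpM2r => //; rewrite normfV normrX (gtr0_norm (m0 n)).
  rewrite lef_pV2 ?posrE ?exprn_gt0// lerXn2r ?nnegrE ?(ltW (m0 _))//.
  by move: Nn; rewrite leq_eqVlt => /predU1P[->//|/minc/ltW].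
Qed.

(** In the moments of large order the smaller of the first two nodes that differ
    dominates every later node of both families, and its weight is nonzero. *)
Lemma moments_not_lt c m m' K n : (forall n, 0 < m n) -> (forall n, 0 < m' n) ->
  {homo m : i j / (i < j)%N >-> i < j} -> {homo m' : i j / (i < j)%N >-> i < j} ->
  (forall k, (K <= k)%N -> asum (fun n => c n * m n ^- k)) ->
  (forall k, (K <= k)%N -> asum (fun n => c n * m' n ^- k)) ->
  (forall N, exists2 k, (N <= k)%N & power_moment c m k = power_moment c m' k) ->
  c n != 0 -> (forall i, (i < n)%N -> m i = m' i) -> ~ m n < m' n.
Proof.
move=> m0 m'0 minc m'inc hK hK' hk cn IH mn.
pose T := ssum (fun n => `|c n * m n ^- K|) * m n ^+ K.
pose T' := ssum (fun n => `|c n * m' n ^- K|) * m n ^+ K.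
have cn2 : 0 < `|c n| / 2 by rewrite divr_gt0// normr_gt0.
have q1 : 0 <= m n / m n.+1 < 1.
  by rewrite divr_ge0 ?(ltW (m0 _))//= ltr_pdivrMr// mul1r minc.
have q2 : 0 <= m n / m' n < 1.
  by rewrite divr_ge0 ?(ltW (m0 _)) ?(ltW (m'0 _))//= ltr_pdivrMr// mul1r.
have [N1 h1] := geometric_small T q1 cn2.
have [N2 h2] := geometric_small T' q2 cn2.
have [k hkk ek] := hk (K + N1 + N2)%N.
have Kk : (K <= k)%N by apply: leq_trans hkk; rewrite -addnA leq_addr.
have b1 := h1 (k - K)%N; rewrite leq_subRL// in b1.
have {}b1 := b1 (leq_trans (leq_addr _ _) hkk).
have b2 := h2 (k - K)%N; rewrite leq_subRL// in b2.
have {}b2 : T' * (m n / m' n) ^+ (k - K) < `|c n| / 2.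
  by apply: b2; apply: leq_trans hkk; rewrite leq_add2r leq_addr.
have t1 := power_moment_tail n.+1 m0 minc hK Kk.
have t2 := power_moment_tail n m'0 m'inc hK' Kk.
rewrite big_ord_recr/= ek in t1.
have eS : \sum_(i < n) c i * m i ^- k = \sum_(i < n) c i * m' i ^- k.
  by apply: eq_bigr => i _; rewrite IH.
rewrite eS in t1.
set A := power_moment _ _ _ in t1 t2; set S := \sum_(i < n) _ in t1 t2.
have mk0 : 0 < m n ^+ k by rewrite exprn_gt0.
have : `|c n * m n ^- k| * m n ^+ k <=
   (ssum (fun n => `|c n * m n ^- K|) * m n.+1 ^- (k - K) +
    ssum (fun n => `|c n * m' n ^- K|) * m' n ^- (k - K)) * m n ^+ k.
  rewrite ler_pM2r//.
  have -> : c n * m n ^- k = (A - S) - (A - (S + c n * m n ^- k)) by ring.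
  by apply: (le_trans (ler_normB _ _)); rewrite addrC lerD.
rewrite normrM normfV (gtr0_norm mk0) divfK ?gt_eqF// => hc.
have : `|c n| < `|c n| / 2 + `|c n| / 2.
  apply: (le_lt_trans hc); rewrite mulrDl; apply: ltrD.
    apply: le_lt_trans b1.
    have -> : m n ^+ k = m n ^+ K * m n ^+ (k - K) by rewrite -exprD subnKC.
    rewrite expr_div_n /T.
    by rewrite le_eqVlt; apply/orP; left; apply/eqP; ring.
  apply: le_lt_trans b2.
  have -> : m n ^+ k = m n ^+ K * m n ^+ (k - K) by rewrite -exprD subnKC.
  rewrite expr_div_n /T'.
  by rewrite le_eqVlt; apply/orP; left; apply/eqP; ring.
by have := splitr `|c n|; lra.
Qed.

Lemma moments_inj c m m' K : (forall n, c n != 0) ->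
  (forall n, 0 < m n) -> (forall n, 0 < m' n) ->
  {homo m : i j / (i < j)%N >-> i < j} -> {homo m' : i j / (i < j)%N >-> i < j} ->
  (forall k, (K <= k)%N -> asum (fun n => c n * m n ^- k)) ->
  (forall k, (K <= k)%N -> asum (fun n => c n * m' n ^- k)) ->
  (forall N, exists2 k, (N <= k)%N & power_moment c m k = power_moment c m' k) ->
  forall n, m n = m' n.
Proof.
move=> c0 m0 m'0 minc m'inc hK hK' hk; elim/ltn_ind => n IH.
apply/eqP; rewrite eq_le !leNgt; apply/andP; split; apply/negP.
  apply: (@moments_not_lt c m' m K) => // [N|i /IH//].
  by have [k Nk ek] := hk N; exists k.
exact: (@moments_not_lt c m m' K).
Qed.

Lemma power_moment_neq0 c m K : c 0%N != 0 -> (forall n, 0 < m n) ->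
  {homo m : i j / (i < j)%N >-> i < j} ->
  (forall k, (K <= k)%N -> asum (fun n => c n * m n ^- k)) ->
  exists N, forall k, (N <= k)%N -> power_moment c m k != 0.
Proof.
move=> c0 m0 minc hK.
pose T := ssum (fun n => `|c n * m n ^- K|) * m 0%N ^+ K.
have q1 : 0 <= m 0%N / m 1%N < 1.
  by rewrite divr_ge0 ?(ltW (m0 _))//= ltr_pdivrMr// mul1r minc.
have cn : 0 < `|c 0%N| by rewrite normr_gt0.
have [N1 h1] := geometric_small T q1 cn.
exists (K + N1)%N => k hk; apply/eqP => A0.
have Kk : (K <= k)%N by apply: leq_trans hk; exact: leq_addr.
have b1 := h1 (k - K)%N; rewrite leq_subRL// in b1; have {}b1 := b1 hk.
have t1 := power_moment_tail 1 m0 minc hK Kk.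
rewrite A0 big_ord1 sub0r normrN in t1.
have mk0 : 0 < m 0%N ^+ k by rewrite exprn_gt0.
rewrite -(ler_pM2r mk0) normrM normfV (gtr0_norm mk0) divfK ?gt_eqF// in t1.
move: b1; rewrite ltNge => /negP; apply; apply: (le_trans t1).
have -> : m 0%N ^+ k = m 0%N ^+ K * m 0%N ^+ (k - K) by rewrite -exprD subnKC.
rewrite expr_div_n /T.
by rewrite le_eqVlt; apply/orP; left; apply/eqP; ring.
Qed.

End moments.

(** * Recovering the order and the nodes *)

Section inverse_problem.
Context {R : realType}.

(** Its roots are the exponentials of the exponents [b k] and [b' k] for
    [1 <= k <= K], so one filter serves both series. *)
Definition killing_poly (b b' : R) (K : nat) : {poly R} :=
  (\prod_(k < K) ('X - (expR (b * k.+1%:R))%:P)) *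
  \prod_(k < K) ('X - (expR (b' * k.+1%:R))%:P).

Lemma killing_polyC (b b' : R) K : killing_poly b b' K = killing_poly b' b K.
Proof. exact: mulrC. Qed.

Lemma killing_poly_root (b b' : R) K k : (0 < k <= K)%N ->
  (killing_poly b b' K).[expR (b * k%:R)] = 0.
Proof.
case: k => // k /= kK; rewrite hornerM horner_prod (bigD1 (Ordinal kK))//=.
by rewrite hornerXsubC subrr !mul0r.
Qed.

Lemma killing_poly_neq0 (b b' : R) K k : 0 < b -> 0 < b' ->
  (K < k)%N -> b' * K%:R < b * k%:R ->
  (killing_poly b b' K).[expR (b * k%:R)] != 0.
Proof.
move=> b0 b'0 Kk bk; rewrite hornerM !horner_prod mulf_neq0//; apply/prodf_neq0 => i _;
  rewrite hornerXsubC subr_eq0; apply/eqP => /expR_inj.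
  move/(mulfI (lt0r_neq0 b0))/eqP; rewrite eqr_nat => /eqP ki.
  by move: Kk; rewrite ki ltnNge ltn_ord.
by move=> e; move: bk; rewrite e ltNge ler_pM2l// ler_nat ltn_ord.
Qed.

Lemma ML_asymp_neq0 (b : R) k : ~ is_nat_mult b k -> ML_asymp b k != 0.
Proof.
move=> h; rewrite /ML_asymp mulf_neq0 ?signr_eq0//; apply: rgamma_neq0 => i.
apply/eqP => e; apply: h; exists i.+1; rewrite -natr1.
by lra.
Qed.

Variables (b b' : R) (c m m' : nat -> R) (K : nat) (y0 : R).
Hypotheses (b01 : 0 < b < 1) (b'01 : 0 < b' < 1).
Hypotheses (m_gt0 : forall n, 0 < m n) (m'_gt0 : forall n, 0 < m' n).
Hypothesis m_inc : {homo m : i j / (i < j)%N >-> i < j}.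
Hypothesis m'_inc : {homo m' : i j / (i < j)%N >-> i < j}.
Hypothesis cm_sum : forall k, (K <= k)%N -> asum (fun n => c n * m n ^- k).
Hypothesis cm'_sum : forall k, (K <= k)%N -> asum (fun n => c n * m' n ^- k).
Hypothesis c_neq0 : forall n, c n != 0.
Hypothesis trace_eq : forall y, y <= y0 -> exists l : R,
  series (fun n => c n * ML b 1 (m n * expR (b * y))) @ \oo --> l /\
  series (fun n => c n * ML b' 1 (m' n * expR (b' * y))) @ \oo --> l.

Let P := killing_poly b b' K.

Let b0 : 0 < b. Proof. by case/andP: b01. Qed.
Let b'0 : 0 < b'. Proof. by case/andP: b'01. Qed.

Let P_root k : (0 < k <= K)%N -> P.[expR (b * k%:R)] = 0.
Proof. exact: killing_poly_root. Qed.

Let P_root' k : (0 < k <= K)%N -> P.[expR (b' * k%:R)] = 0.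
Proof. by rewrite /P killing_polyC; exact: killing_poly_root. Qed.

Let filtered_series_cvg (d : R) (x : nat -> R) (l : nat -> R) (y : R) :
  (forall i : nat, series (fun n => c n * ML d 1 (x n * expR (d * (y - i%:R)))) @ \oo --> l i) ->
  series (fun n => c n * filtered_mode d x P n y) @ \oo -->
    \sum_(i < size P) P`_i * l i.
Proof.
move=> h.
have -> : series (fun n => c n * filtered_mode d x P n y) = (fun N =>
    \sum_(i < size P) P`_i * series (fun n => c n * ML d 1 (x n * expR (d * (y - i%:R)))) N).
  apply/funext => N; rewrite seriesEord/= /filtered_mode.
  under eq_bigr do rewrite mulr_sumr.
  rewrite exchange_big/=; apply: eq_bigr => i _.
  by rewrite seriesEord/= mulr_sumr; apply: eq_bigr => n _; ring.
by apply: (@cvg_big _ _ +%R 0 _ add_continuous) => i _; exact: cvgMr.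
Qed.

Let filtered_eq_le y : y <= y0 -> filtered_sum b c m P y = filtered_sum b' c m' P y.
Proof.
move=> yy0.
have shifted (i : nat) : exists l : R,
    series (fun n => c n * ML b 1 (m n * expR (b * (y - i%:R)))) @ \oo --> l /\
    series (fun n => c n * ML b' 1 (m' n * expR (b' * (y - i%:R)))) @ \oo --> l.
  by apply: trace_eq; rewrite (le_trans _ yy0)// gerBl.
have [l hl] := choice shifted.
rewrite /filtered_sum.
by rewrite (ssum_eq (filtered_series_cvg (fun i => (hl i).1)))
           (ssum_eq (filtered_series_cvg (fun i => (hl i).2))).
Qed.

(** Both filtered sums are analytic in [y] with a uniform radius and agree on a
    half-line. *)
Let filtered_eq y : filtered_sum b c m P y = filtered_sum b' c m' P y.
Proof.
have [r r0 hr] := filtered_sum_taylor b01 m_gt0 cm_sum P_root.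
have [r' r'0 hr'] := filtered_sum_taylor b'01 m'_gt0 cm'_sum P_root'.
pose F z := filtered_sum b c m P z + (- 1) * filtered_sum b' c m' P z.
suff : F y = 0 by rewrite /F mulN1r => /eqP; rewrite subr_eq0 => /eqP.
apply: (@taylor_identity _ F (r + r') _ _ y0); first by rewrite addr_gt0.
  move=> z; have [W W0 hW] := hr z; have [W' W'0 hW'] := hr' z.
  exists (W + `|- 1| * W'); apply: taylor_atD.
    by apply: (@taylor_at_le _ r _ W) => //; rewrite ?W0 ?lexx// (ltW r0)/= lerDl ltW.
  apply: taylor_atZ.
  by apply: (@taylor_at_le _ r' _ W') => //; rewrite ?W'0 ?lexx// (ltW r'0)/= lerDr ltW.
by move=> z zy0; rewrite /F filtered_eq_le// mulN1r subrr.
Qed.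

Let match_bound J : (K <= J)%N -> exists C : R, forall y, 0 <= y ->
  `|\sum_(K.+1 <= k < J.+1) asymp_coef b c m P k * expR (- (b * k%:R * y)) -
    \sum_(K.+1 <= k < J.+1) asymp_coef b' c m' P k * expR (- (b' * k%:R * y))| <=
  C * expR (- (Num.min b b' * J%:R * y)).
Proof.
move=> KJ.
have [C hC] := filtered_sum_asymp b01 m_gt0 cm_sum P_root KJ.
have [C' hC'] := filtered_sum_asymp b'01 m'_gt0 cm'_sum P_root' KJ.
exists (`|C| + `|C'|) => y yge0.
set A := \sum_(_ <= k < _) asymp_coef b _ _ _ _ * _.
set B := \sum_(_ <= k < _) asymp_coef b' _ _ _ _ * _.
have -> : A - B = (filtered_sum b' c m' P y - B) - (filtered_sum b c m P y - A).
  by rewrite filtered_eq; ring.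
have dom (d x : R) : Num.min b b' <= d ->
    x * expR (- (d * J%:R * y)) <= `|x| * expR (- (Num.min b b' * J%:R * y)).
  move=> md; apply: (@le_trans _ _ (`|x| * expR (- (d * J%:R * y)))).
    by rewrite ler_wpM2r ?expR_ge0// ler_norm.
  by rewrite ler_wpM2l// ler_expR lerN2 ler_wpM2r// ler_wpM2r.
apply: (le_trans (ler_normB _ _)); rewrite addrC mulrDl; apply: lerD.
  by apply: (le_trans (hC y)); apply: dom; rewrite ge_min lexx.
by apply: (le_trans (hC' y)); apply: dom; rewrite ge_min lexx orbT.
Qed.

Let match_bound' J : (K <= J)%N -> exists C : R, forall y, 0 <= y ->
  `|\sum_(K.+1 <= k < J.+1) asymp_coef b' c m' P k * expR (- (b' * k%:R * y)) -
    \sum_(K.+1 <= k < J.+1) asymp_coef b c m P k * expR (- (b * k%:R * y))| <=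
  C * expR (- (Num.min b' b * J%:R * y)).
Proof.
move=> /match_bound[C hC]; exists C => y /hC.
by rewrite -normrN opprB minC.
Qed.

Let large (d : R) : 0 < d -> exists N, forall k, (N <= k)%N ->
  (K < k)%N /\ (b + b') * K%:R < d * k%:R.
Proof.
move=> d0; exists (maxn K (Num.truncn ((b + b') * K%:R / d))).+1 => k.
rewrite gtn_max => /andP[Kk h]; split=> //.
rewrite [ltRHS]mulrC -ltr_pdivrMr//; apply: (lt_le_trans (truncnS_gt _)).
by rewrite ler_nat.
Qed.

Let coef_neq0 : exists N, forall k, (N <= k)%N -> ~ is_nat_mult b k ->
  (K < k)%N /\ asymp_coef b c m P k != 0.
Proof.
have [N1 h1] := power_moment_neq0 (c_neq0 0%N) m_gt0 m_inc cm_sum.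
have [N2 h2] := large b0.
exists (N1 + N2)%N => k Nk nk.
have [Kk bk] := h2 k (leq_trans (leq_addl _ _) Nk); split=> //.
rewrite /asymp_coef; apply: mulf_neq0; last exact: h1 (leq_trans (leq_addr _ _) Nk).
apply: mulf_neq0; first exact: ML_asymp_neq0.
apply: killing_poly_neq0 => //; apply: le_lt_trans bk.
by rewrite ler_wpM2r// lerDr ltW.
Qed.

Let coef_neq0' : exists N, forall k, (N <= k)%N -> ~ is_nat_mult b' k ->
  (K < k)%N /\ asymp_coef b' c m' P k != 0.
Proof.
have [N1 h1] := power_moment_neq0 (c_neq0 0%N) m'_gt0 m'_inc cm'_sum.
have [N2 h2] := large b'0.
exists (N1 + N2)%N => k Nk nk.
have [Kk bk] := h2 k (leq_trans (leq_addl _ _) Nk); split=> //.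
rewrite /asymp_coef; apply: mulf_neq0; last exact: h1 (leq_trans (leq_addr _ _) Nk).
apply: mulf_neq0; first exact: ML_asymp_neq0.
rewrite /P killing_polyC; apply: killing_poly_neq0 => //; apply: le_lt_trans bk.
by rewrite ler_wpM2r// lerDl ltW.
Qed.

(** For large [k] the only coefficients that vanish are those with [b k]
    integral. *)
Lemma trace_determines_order : b = b'.
Proof.
have [N h] := coef_neq0; have [N' h'] := coef_neq0'.
apply: (@progression_step_eq _ b b' (N + N')) => // k Nk nk.
  have [Kk ak] := h k (leq_trans (leq_addr _ _) Nk) nk.
  exact: (exponent_match b0 b'0 match_bound Kk).1.
have [Kk ak] := h' k (leq_trans (leq_addl _ _) Nk) nk.
exact: (exponent_match b'0 b0 match_bound' Kk).1.
Qed.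

(** The factors other than the moments depend on [b] only, and of two
    consecutive orders at least one is visible. *)
Lemma trace_determines_nodes n : m n = m' n.
Proof.
have bb' := trace_determines_order.
apply: (@moments_inj _ c m m' K) => // N.
have [N2 h2] := large b0.
have [k Nk nk] : exists2 k, (N + N2 <= k)%N & ~ is_nat_mult b k.
  have [S|S] := pselect (is_nat_mult b (N + N2)); last by exists (N + N2)%N.
  by exists (N + N2).+1 => //; exact: nat_mult_gap.
exists k; first exact: leq_trans (leq_addr _ _) Nk.
have [Kk bk] := h2 k (leq_trans (leq_addl _ _) Nk).
have := (exponent_match b0 b'0 match_bound Kk).2 bb'.
rewrite /asymp_coef -bb' => /mulfI; apply.
rewrite mulf_neq0 ?ML_asymp_neq0//; apply: killing_poly_neq0 => //.
by apply: le_lt_trans bk; rewrite ler_wpM2r// lerDr ltW.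
Qed.

End inverse_problem.

(** * Eigenvalues and the trace at the midpoint *)

Section eigenvalues.
Context {R : realType}.

Lemma psi0S (n : nat) : psi n.+2 0 = - psi n (0 : R).
Proof.
rewrite /psi -sinDpi; congr sin; rewrite -addn2 natrD.
by field.
Qed.

Lemma psi0_even (j : nat) : psi j.*2 0 = (0 : R).
Proof.
elim: j => [|j IH]; first by rewrite /psi !mul0r sin0.
by rewrite doubleS psi0S IH oppr0.
Qed.

Lemma psi0_odd (j : nat) : `|psi j.*2.+1 0| = (1 : R).
Proof.
elim: j => [|j IH]; first by rewrite /psi mul1r add0r mulr1 sin_pihalf normr1.
by rewrite doubleS psi0S normrN.
Qed.

Lemma le_nat_frequency (n : nat) : n%:R <= n%:R * pi / 2 :> R.
Proof.
rewrite -mulrA -[leLHS]mulr1 ler_wpM2l// ler_pdivlMr// mul1r.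
exact: pi_ge2.
Qed.

Lemma mubar_powR (n : nat) (a : R) : mubar n `^ (a / 2) = (n%:R * pi / 2) `^ a.
Proof.
have x0 : 0 <= n%:R * pi / 2 :> R by rewrite (le_trans _ (le_nat_frequency n)).
rewrite /mubar -(powR_mulrn 2 x0) -powRrM; congr (_ `^ _).
by field.
Qed.

Lemma eigvalE (a g : R) (n : nat) :
  eigval a g n = (n%:R * pi / 2) `^ a + (n%:R * pi / 2) `^ g.
Proof. by rewrite /eigval !mubar_powR. Qed.

Lemma powR_nat_le_eigval (a g : R) n : 0 <= g -> n%:R `^ g <= eigval a g n.
Proof.
move=> g0; rewrite eigvalE; apply: (@le_trans _ _ ((n%:R * pi / 2) `^ g)).
  by apply: ge0_ler_powR; rewrite ?nnegrE ?(le_trans _ (le_nat_frequency n))//;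
    exact: le_nat_frequency.
by rewrite lerDr powR_ge0.
Qed.

Lemma eigval_ge1 (a g : R) n : 0 <= g -> (0 < n)%N -> 1 <= eigval a g n.
Proof.
move=> g0 n0; apply: le_trans (powR_nat_le_eigval a n g0).
by rewrite -[leLHS](powRr0 n%:R) ler_powR// ler1n.
Qed.

Lemma eigval_inc (a g : R) : 0 < a -> 0 < g ->
  {homo eigval a g : i j / (i < j)%N >-> i < j}.
Proof.
move=> a0 g0 i j ij; rewrite !eigvalE.
have x0 n : 0 <= n%:R * pi / 2 :> R by rewrite (le_trans _ (le_nat_frequency n)).
have xx : i%:R * pi / 2 < j%:R * pi / 2 :> R.
  by rewrite -!mulrA ltr_pM2r ?ltr_nat// divr_gt0// pi_gt0.
by apply: ltrD; apply: gt0_ltr_powR; rewrite ?nnegrE.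
Qed.

Lemma asum_inv_square : asum (fun n => (n.+1%:R ^+ 2)^-1 : R).
Proof.
apply: (@asum_bounded _ _ 2) => n.
suff : \sum_(k < n) `|(k.+1%:R ^+ 2)^-1| <= 2 - 2 * n.+1%:R^-1 :> R.
  by move/le_trans; apply; rewrite gerBl mulr_ge0.
elim: n => [|n IH]; first by rewrite big_ord0 invr1 mulr1 subrr.
rewrite big_ord_recr/=; apply: (le_trans (lerD IH (lexx _))).
rewrite ger0_norm ?invr_ge0 ?exprn_ge0//.
have n0 : (0 : R) <= n%:R by [].
have -> : (n.+2%:R : R) = n%:R + 2 by rewrite -addn2 natrD.
have -> : (n.+1%:R : R) = n%:R + 1 by rewrite -natr1.
rewrite -subr_ge0.
have -> : 2 - 2 / (n%:R + 2) - (2 - 2 / (n%:R + 1) + (n%:R + 1) ^- 2) =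
  n%:R / ((n%:R + 1) ^+ 2 * (n%:R + 2)) :> R.
  by field; apply/andP; split; rewrite gt_eqF//; lra.
by rewrite divr_ge0// mulr_ge0 ?exprn_ge0//; lra.
Qed.

Lemma asum_eigval_moment (a g B : R) (c : nat -> R) K k : 0 < g ->
  (forall n, `|c n| <= B) -> 2 <= g * K%:R -> (K <= k)%N ->
  asum (fun n => c n * eigval a g n.*2.+1 ^- k).
Proof.
move=> g0 cB gK Kk.
apply: (@asum_le _ _ (fun n => B * (n.+1%:R ^+ 2)^-1)); last first.
  by apply: asumZ; exact: asum_inv_square.
move=> n; have n1 : (1 : R) <= n.+1%:R by rewrite ler1n.
have B0 : 0 <= B by exact: le_trans (cB 0%N).
rewrite [leRHS]ger0_norm; last by rewrite mulr_ge0// invr_ge0 exprn_ge0.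
have e0 : 0 < eigval a g n.*2.+1.
  by apply: (lt_le_trans ltr01); apply: eigval_ge1 => //; exact: ltW.
rewrite normrM normfV normrX (gtr0_norm e0); apply: ler_pM => //.
  by rewrite invr_ge0 exprn_ge0// ltW.
rewrite lef_pV2 ?posrE ?exprn_gt0 ?ltr0n//.
apply: (@le_trans _ _ ((n.+1%:R `^ g) ^+ k)).
  rewrite -powR_mulrn ?powR_ge0// -powRrM -powR_mulrn//; apply: ler_powR => //.
  by apply: (le_trans gK); rewrite ler_wpM2l ?(ltW g0)// ler_nat.
rewrite lerXn2r ?nnegrE ?powR_ge0 ?(ltW e0)//.
apply: le_trans (powR_nat_le_eigval a n.*2.+1 (ltW g0)).
apply: ge0_ler_powR; rewrite ?nnegrE ?(ltW g0)// ler_nat ltnS.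
by rewrite -addnn leq_addr.
Qed.

Lemma powR_exponent_inj (x a b : R) : 1 < x -> x `^ a = x `^ b -> a = b.
Proof.
move=> x1; have x0 : 0 < x by lra.
rewrite /powR gt_eqF// => /expR_inj/(mulIf _); apply.
by rewrite gt_eqF// ln_gt0.
Qed.

Let eigval_eq_not_lt (a g a' g' : R) : a <= g ->
  (forall j, eigval a g j.*2.+1 = eigval a' g' j.*2.+1) -> ~ g < g'.
Proof.
move=> ag e gg'.
pose x j : R := j.*2.+1%:R * pi / 2.
have xj j : j%:R <= x j.
  by apply: le_trans (le_nat_frequency _); rewrite ler_nat -addnn -addnS leq_addr.
have x1 j : 1 <= x j by apply: le_trans (le_nat_frequency _); rewrite ler1n.
have x0 j : 0 < x j by exact: lt_le_trans (x1 j).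
have d0 : 0 < g' - g by rewrite subr_gt0.
have le2 j : x j `^ (g' - g) <= 2.
  rewrite powRB; last by rewrite (gt_eqF (x0 j)) implybT.
  rewrite ler_pdivrMr ?powR_gt0//.
  have := e j; rewrite !eigvalE -/(x j) => ej.
  have h1 : x j `^ a <= x j `^ g by exact: ler_powR.
  have h2 := powR_ge0 (x j) a'.
  by lra.
pose j := (Num.truncn ((3 : R) `^ (g' - g)^-1)).+1.
have : 3 `^ (g' - g)^-1 <= x j by apply: le_trans (xj j); exact/ltW/truncnS_gt.
move/(ge0_ler_powR (ltW d0)); rewrite !nnegrE powR_ge0 (ltW (x0 j)) => /(_ isT isT).
rewrite -powRrM mulVf ?gt_eqF// powRr1// => h.
by have := le_trans h (le2 j); rewrite ler_nat.
Qed.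

(** The larger exponent is read off the growth of the eigenvalues, the other
    one from the eigenvalue of index 3; at that index the base exceeds 1. *)
Lemma eigval_exponents_inj (a g a' g' : R) : a <= g -> a' <= g' ->
  (forall j, eigval a g j.*2.+1 = eigval a' g' j.*2.+1) -> a = a' /\ g = g'.
Proof.
move=> ag ag' e.
have eg : g = g'.
  apply/eqP; rewrite eq_le !leNgt; apply/andP; split; apply/negP.
    by apply: (@eigval_eq_not_lt a' g' a g) => // j; rewrite e.
  exact: (@eigval_eq_not_lt a g a' g').
split=> //; have := e 1%N; rewrite eg !eigvalE => /addIr.
by apply: powR_exponent_inj; apply: lt_le_trans (le_nat_frequency _); rewrite ltr1n.
Qed.

Lemma Hdot_coef_bounded (a g : R) (f : R -> R) : 0 <= g -> Hdot a g f ->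
  exists B : R, forall n, (0 < n)%N -> `|inner f (psi n)| <= B.
Proof.
move=> g0 [_ /cvg_seq_bounded/bounded_fun_has_ubound[B hB]].
exists (B + 1) => n n0.
have t0 k : 0 <= eigval a g k ^+ 2 * inner f (psi k) ^+ 2.
  by rewrite mulr_ge0// sqr_ge0.
have h : inner f (psi n) ^+ 2 <= B.
  apply: (@le_trans _ _ (eigval a g n ^+ 2 * inner f (psi n) ^+ 2)).
    by rewrite ler_peMl ?sqr_ge0// exprn_ege1// eigval_ge1.
  apply: le_trans (hB _ (ex_intro2 _ _ n.+1 Logic.I erefl)).
  by rewrite big_nat_recr//= lerDr sumr_ge0.
have [x1|x1] := leP `|inner f (psi n)| 1.
  by apply: (le_trans x1); rewrite lerDr (le_trans _ h)// sqr_ge0.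
apply: (@le_trans _ _ (`|inner f (psi n)| ^+ 2)).
  by rewrite expr2 ler_peMl// ltW.
by rewrite real_normK ?num_real//; lra.
Qed.

End eigenvalues.

Section trace.
Context {R : realType}.

Lemma mittag_lefflerE (b x : R) : 0 < b -> mittag_leffler b (- x) = ML b 1 x.
Proof.
move=> b0; rewrite /mittag_leffler /ML /ML_theta; apply: eq_ssum => k.
by rewrite rgamma_inv ?ge1_betab// (expr0 k%:R) mulr1 mulrC.
Qed.

Lemma expansion0E (b a g : R) (f : R -> R) (t : R) (N : nat) : 0 < b -> 0 < t ->
  expansion b a g f t 0 N.*2.+1 =
  series (fun j => inner f (psi j.*2.+1) * psi j.*2.+1 0 *
    ML b 1 (eigval a g j.*2.+1 * expR (b * ln t))) N.
Proof.
move=> b0 t0; rewrite /expansion seriesEord/=.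
have tb : t `^ b = expR (b * ln t) by rewrite /powR gt_eqF.
elim: N => [|N IH]; first by rewrite big_ord0 big_geq.
rewrite doubleS big_nat_recr//= big_nat_recr//= IH big_ord_recr/=.
rewrite -[N.*2.+2]doubleS psi0_even mulr0 addr0; congr (_ + _).
by rewrite mulNr mittag_lefflerE// tb; ring.
Qed.

Lemma cvg_double_succ : (fun N => N.*2.+1) @ \oo --> \oo.
Proof.
move=> A [N _ hN]; exists N => // k /= Nk; apply: hN => /=.
by rewrite (leq_trans Nk)// -addnn -addnS leq_addr.
Qed.

Lemma trace_series_cvg (b a g : R) (f : R -> R) (t l : R) : 0 < b -> 0 < t ->
  expansion b a g f t 0 @ \oo --> l ->
  series (fun j => inner f (psi j.*2.+1) * psi j.*2.+1 0 *
    ML b 1 (eigval a g j.*2.+1 * expR (b * ln t))) @ \oo --> l.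
Proof.
move=> b0 t0 h.
have := @cvg_comp _ _ _ _ (expansion b a g f t 0) _ _ _ (@cvg_double_succ) h.
apply: cvg_trans.
by apply: near_eq_cvg; apply: nearW => N /=; rewrite expansion0E.
Qed.

End trace.

Theorem theorem3p3 (R : realType) (T beta beta' alpha gamma alpha' gamma' : R)
    (f : R -> R) (u v : R -> R -> R)
    (T_gt0 : 0 < T)
    (beta01 : 0 < beta < 1) (beta01' : 0 < beta' < 1)
    (alpha_gt0 : 0 < alpha) (alpha_gamma : alpha <= gamma)
    (gamma_lt2 : gamma < 2)
    (alpha_gt0' : 0 < alpha') (alpha_gamma' : alpha' <= gamma')
    (gamma_lt2' : gamma' < 2)
    (fH : Hdot alpha gamma f) (fH' : Hdot alpha' gamma' f)
    (f_odd : (forall n : nat, odd n -> 0 < inner f (psi n)) \/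
             (forall n : nat, odd n -> inner f (psi n) < 0))
    (u_sol : weak_solution T beta alpha gamma f u)
    (v_sol : weak_solution T beta' alpha' gamma' f v)
    (* u(t,0) and v(t,0) are the values at 0 of the eigenfunction series *)
    (u_at0 : forall t, 0 < t <= T ->
       expansion beta alpha gamma f t 0 @ \oo --> u t 0)
    (v_at0 : forall t, 0 < t <= T ->
       expansion beta' alpha' gamma' f t 0 @ \oo --> v t 0)
    (uv_eq : forall t, 0 < t <= T -> u t 0 = v t 0) :
  [/\ beta = beta', alpha = alpha' & gamma = gamma'].
Proof.
have gamma_gt0 : 0 < gamma by exact: lt_le_trans alpha_gamma.
have gamma_gt0' : 0 < gamma' by exact: lt_le_trans alpha_gamma'.
have beta_gt0 : 0 < beta by case/andP: beta01.
have beta_gt0' : 0 < beta' by case/andP: beta01'.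
pose c j := inner f (psi j.*2.+1) * psi j.*2.+1 0.
have c_neq0 j : c j != 0.
  rewrite mulf_neq0//; last by rewrite -normr_eq0 psi0_odd oner_neq0.
  have odd_j : odd j.*2.+1 by rewrite /= odd_double.
  by case: f_odd => h; [rewrite gt_eqF// h|rewrite lt_eqF// h].
have [B hB] := Hdot_coef_bounded (ltW gamma_gt0) fH.
have cB j : `|c j| <= B by rewrite normrM psi0_odd mulr1 hB.
(* gamma K >= 2 makes the sum of the m_j ^ (- K) converge like that of j ^ (- 2) *)
pose K := (Num.truncn (2 / gamma) + Num.truncn (2 / gamma') + 1)%N.
have gK : 2 <= gamma * K%:R.
  rewrite mulrC -ler_pdivrMr//; apply: (le_trans (ltW (truncnS_gt _))).
  by rewrite ler_nat /K addn1 ltnS leq_addr.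
have gK' : 2 <= gamma' * K%:R.
  rewrite mulrC -ler_pdivrMr//; apply: (le_trans (ltW (truncnS_gt _))).
  by rewrite ler_nat /K addn1 ltnS leq_addl.
have m_gt0 (a g : R) : 0 < g -> forall j, 0 < eigval a g j.*2.+1.
  by move=> g0 j; apply: (lt_le_trans ltr01); apply: eigval_ge1 => //; exact: ltW.
have m_inc (a g : R) : 0 < a -> 0 < g ->
    {homo (fun j => eigval a g j.*2.+1) : i j / (i < j)%N >-> i < j}.
  by move=> a0 g0 i j ij; apply: eigval_inc => //; rewrite ltnS ltn_double.
have trace_eq y : y <= ln T -> exists l : R,
   series (fun j => c j * ML beta 1 (eigval alpha gamma j.*2.+1 * expR (beta * y))) @ \oo --> l /\
   series (fun j => c j * ML beta' 1 (eigval alpha' gamma' j.*2.+1 * expR (beta' * y))) @ \oo --> l.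
  move=> yT; exists (u (expR y) 0).
  have tT : 0 < expR y <= T by rewrite expR_gt0/= -[T]lnK ?posrE// ler_expR.
  have h1 := @trace_series_cvg _ _ _ _ _ _ _ beta_gt0 (expR_gt0 y) (u_at0 _ tT).
  have h2 := @trace_series_cvg _ _ _ _ _ _ _ beta_gt0' (expR_gt0 y) (v_at0 _ tT).
  rewrite expRK in h1 h2; rewrite -(uv_eq _ tT) in h2.
  by split; [exact: h1|exact: h2].
have sum1 k : (K <= k)%N -> asum (fun n => c n * eigval alpha gamma n.*2.+1 ^- k).
  exact: asum_eigval_moment.
have sum2 k : (K <= k)%N -> asum (fun n => c n * eigval alpha' gamma' n.*2.+1 ^- k).
  exact: asum_eigval_moment.
have bb : beta = beta'.
  exact: (trace_determines_order beta01 beta01' (m_gt0 alpha _ gamma_gt0)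
    (m_gt0 alpha' _ gamma_gt0') (m_inc _ _ alpha_gt0 gamma_gt0)
    (m_inc _ _ alpha_gt0' gamma_gt0') sum1 sum2 c_neq0 trace_eq).
have mm := trace_determines_nodes beta01 beta01' (m_gt0 alpha _ gamma_gt0)
    (m_gt0 alpha' _ gamma_gt0') (m_inc _ _ alpha_gt0 gamma_gt0)
    (m_inc _ _ alpha_gt0' gamma_gt0') sum1 sum2 c_neq0 trace_eq.
by have [aa gg] := eigval_exponents_inj alpha_gamma alpha_gamma' mm.
Qed.
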